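(* Fix $p\in[2,\infty)$, $d,n\in\mathbb N$ and $k\in\{1,\ldots,n\}$. Then for every $A_1,\ldots,A_n\in M_d(\mathbb R)$, $$\frac{(p/\sqrt{\log p})^{-p}}{2^n\binom nk}\sum_{\substack{S\subset\{1,\ldots,n\}\\|S|=k}}\sum_{\varepsilon\in\{-1,1\}^n}\Big\|\sum_{j\in S}\varepsilon_jA_j\Big\|_{S_p}^p\lesssim_p\frac kn\sum_{j=1}^n\|A_j\|_{S_p}^p+\frac{(k/n)^{p/2}}{2^n}\sum_{\varepsilon\in\{-1,1\}^n}\Big\|\sum_{j=1}^n\varepsilon_jA_j\Big\|_{S_p}^p.$$
   Context: For $A\in M_d(\mathbb R)$, $\|A\|_{S_p}=(\mathrm{trace}((A^*A)^{p/2}))^{1/p}$ is the Schatten $p$-norm. $a\lesssim_p b$ means $a\le c^pb$ for a universal constant $c\in(0,\infty)$. *)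

(* Defs.v *)
From Stdlib Require Import Reals List ClassicalEpsilon.
Import ListNotations.
Open Scope R_scope.

(* d x d real matrices, represented as functions; only indices < d matter. *)
Definition Mat := nat -> nat -> R.

Definition lsum {T} (l : list T) (f : T -> R) : R := fold_right Rplus 0 (map f l).
Definition rsum (n : nat) (f : nat -> R) : R := lsum (seq 0 n) f.

Definition mmul (d : nat) (A B : Mat) : Mat := fun i j => rsum d (fun l => A i l * B l j).
Definition mtr (A : Mat) : Mat := fun i j => A j i.
Definition mdiag (lam : nat -> R) : Mat := fun i j => if Nat.eqb i j then lam i else 0.
Definition meq (d : nat) (A B : Mat) : Prop := forall i j, (i < d)%nat -> (j < d)%nat -> A i j = B i j.
Definition orthogonal (d : nat) (Q : Mat) : Prop := meq d (mmul d (mtr Q) Q) (mdiag (fun _ => 1)).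
Definition mtrace (d : nat) (A : Mat) : R := rsum d (fun i => A i i).

(* x^y for x >= 0, y > 0, with 0^y = 0 (Stdlib's Rpower 0 y = 1). *)
Definition rpow (x y : R) : R := if Rle_dec x 0 then 0 else Rpower x y.

(* trace((A^* A)^{p/2}): A^T A = Q diag(lam) Q^T (spectral theorem),
   (A^T A)^{p/2} = Q diag(lam^{p/2}) Q^T. *)
Definition schatten_trace (d : nat) (p : R) (A : Mat) : R :=
  epsilon (inhabits 0) (fun s => exists (Q : Mat) (lam : nat -> R),
     orthogonal d Q /\
     meq d (mmul d (mtr A) A) (mmul d (mmul d Q (mdiag lam)) (mtr Q)) /\
     s = mtrace d (mmul d (mmul d Q (mdiag (fun i => rpow (lam i) (p / 2)))) (mtr Q))).

Definition schatten_norm (d : nat) (p : R) (A : Mat) : R := rpow (schatten_trace d p A) (1 / p).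

Fixpoint bvecs (n : nat) : list (list bool) :=
  match n with
  | O => [[]]
  | S m => map (cons true) (bvecs m) ++ map (cons false) (bvecs m)
  end.

Definition card (s : list bool) : nat := length (filter (fun b : bool => b) s).

(* subsets S of {0..n-1} of size k, encoded as indicator vectors *)
Definition ksubsets (n k : nat) : list (list bool) :=
  filter (fun s => Nat.eqb (card s) k) (bvecs n).

Definition sgn (b : bool) : R := if b then 1 else -1.

Definition signed_sum (n : nat) (A : nat -> Mat) (S eps : list bool) : Mat :=
  fun i l => rsum n (fun j => if nth j S false then sgn (nth j eps false) * A j i l else 0).

(* Main.v *)
Require Import Defs.
From Stdlib Require Import Reals List.
From Stdlib Require Import Arith Lra Lia FunctionalExtensionality ClassicalEpsilon.
From mathcomp Require all_boot all_order all_algebra complex ring Rstruct.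
Import ListNotations.
Open Scope R_scope.

(** Dilating, the [A_j] are symmetric. Flipping one sign and applying the trace form of
    [(x-y)(g(x)-g(y)) <= (x-y)^2 (h(x)+h(y))], with [g(x) = sgn(x)|x|^(p-1)] and
    [h(x) = (p-1)|x|^(p-2)], gives the Khintchine inequality
    [E tr|sum eps_j A_j|^p <= (2(p-1))^(p/2) tr V^(p/2)] with [V = sum A_j^2]; the reverse
    inequality with constant 1 is Jensen's. What remains is a Rosenthal inequality for
    [V_S = sum_{j in S} A_j^2] with a random set [S]. Put [q = p/2], [s = q - 1]. Expanding
    [tr V_S^q = sum_{j in S} tr (B_j V_S^s)], [B_j = A_j^2], one decouples [B_j] from
    [V_S = Y + B_j] through [tr (B (Y+B)^s) <= K1 tr B^q + K2 tr (B Y^s)]: for [s >= 1] the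
    function [f(t) = tr (B (Y+tB)^s)] satisfies [f' <= 2 s f^(1-1/s) (tr B^q)^(1/s)], which
    allows [K2 = sqrt p] and [K1 = (C p / log p)^q]; for [s <= 1] one may take [K1 = K2 = 1].
    Every trace inequality is an inequality between numbers, averaged with the weights
    [<e_i, v_j>^2] of two eigenbases. *)

(** * Finite sums *)

(** The constants obey a budget. The normalisation is [(ln p / p^2)^q] and Khintchine costs
    [(2 p)^q]; up to [c^p], a factor [(ln p / p)^q] remains to pay for [K1] and, since the selection
    bound raises [K2] to the power [q], for [K2^q]. In the convex case a parameter [L] trades the
    two: [K2 = exp (3 s / L)], while [K1] is essentially [K2 L^s]. With [L] of order [p / ln p] the
    term [L^s] uses the whole budget, and [K2] is a power of [p], for which any exponent below 1 is
    affordable. The obstacle is that [B] and [Y] do not commute, so a scalar bound for [b (y+b)^s]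
    says nothing about [tr (B (Y+B)^s)]. Comparing the spectra of two matrices through the quadratic
    form of their difference replaces it, and also avoids differentiating matrix powers. An
    inequality [M <= a + theta M] with [theta < 1], closed by absorption, recurs in Khintchine,
    Jensen, trace monotonicity and the selection bound. *)

Section FiniteSums.
Context {T : Type}.
Implicit Types (l : list T) (f g : T -> R).

Lemma lsum_nil f : lsum nil f = 0.
Proof. reflexivity. Qed.

Lemma lsum_cons a l f : lsum (a :: l) f = f a + lsum l f.
Proof. reflexivity. Qed.

Lemma lsum_app l l' f : lsum (l ++ l') f = lsum l f + lsum l' f.
Proof.
induction l as [|a l IH]; cbn [app]; rewrite ?lsum_nil, ?lsum_cons, ?IH; ring.
Qed.

Lemma lsum_ext l f g : (forall a, In a l -> f a = g a) -> lsum l f = lsum l g.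
Proof.
induction l as [|a l IH]; intros H; [reflexivity|].
rewrite !lsum_cons, H, IH; auto with datatypes.
Qed.

Lemma lsum_le l f g : (forall a, In a l -> f a <= g a) -> lsum l f <= lsum l g.
Proof.
induction l as [|a l IH]; intros H; [rewrite !lsum_nil; lra|].
rewrite !lsum_cons; apply Rplus_le_compat; auto with datatypes.
Qed.

Lemma lsum_plus l f g : lsum l (fun a => f a + g a) = lsum l f + lsum l g.
Proof.
induction l as [|a l IH]; rewrite ?lsum_nil, ?lsum_cons, ?IH; ring.
Qed.

Lemma lsum_minus l f g : lsum l (fun a => f a - g a) = lsum l f - lsum l g.
Proof.
induction l as [|a l IH]; rewrite ?lsum_nil, ?lsum_cons, ?IH; ring.
Qed.

Lemma lsum_scal l c f : lsum l (fun a => c * f a) = c * lsum l f.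
Proof.
induction l as [|a l IH]; rewrite ?lsum_nil, ?lsum_cons, ?IH; ring.
Qed.

Lemma lsum_scal_r l c f : lsum l (fun a => f a * c) = lsum l f * c.
Proof.
induction l as [|a l IH]; rewrite ?lsum_nil, ?lsum_cons, ?IH; ring.
Qed.

Lemma lsum_zero l : lsum l (fun _ => 0) = 0.
Proof.
induction l as [|a l IH]; rewrite ?lsum_nil, ?lsum_cons, ?IH; ring.
Qed.

Lemma lsum_const l c : lsum l (fun _ => c) = INR (length l) * c.
Proof.
induction l as [|a l IH]; [rewrite lsum_nil; simpl; ring|].
rewrite lsum_cons, IH; cbn [length]; rewrite S_INR; ring.
Qed.

Lemma lsum_nonneg l f : (forall a, In a l -> 0 <= f a) -> 0 <= lsum l f.
Proof. intros H; rewrite <- (lsum_zero l); now apply lsum_le. Qed.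

Lemma lsum_map {U} (h : U -> T) (l : list U) f : lsum (map h l) f = lsum l (fun a => f (h a)).
Proof. unfold lsum; now rewrite map_map. Qed.

Lemma lsum_filter (P : T -> bool) l f :
  lsum (filter P l) f = lsum l (fun a => if P a then f a else 0).
Proof.
induction l as [|a l IH]; [reflexivity|].
cbn [filter]; rewrite lsum_cons; destruct (P a); rewrite ?lsum_cons, IH; ring.
Qed.

Lemma lsum_nonneg_eq0 l f a : (forall a, In a l -> 0 <= f a) -> lsum l f = 0 -> In a l -> f a = 0.
Proof.
induction l as [|b l IH]; intros H H0 Ha; [destruct Ha|].
rewrite lsum_cons in H0.
assert (0 <= f b) by auto with datatypes.
assert (0 <= lsum l f) by (apply lsum_nonneg; auto with datatypes).
destruct Ha as [<-|Ha]; [lra|apply IH; auto with datatypes; lra].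
Qed.

End FiniteSums.

Lemma lsum_swap {T U} (l : list T) (l' : list U) (F : T -> U -> R) :
  lsum l (fun a => lsum l' (fun b => F a b)) = lsum l' (fun b => lsum l (fun a => F a b)).
Proof.
induction l as [|a l IH].
- rewrite lsum_nil; symmetry; apply lsum_zero.
- rewrite lsum_cons, IH, <- lsum_plus; reflexivity.
Qed.

Section IndexSums.
Implicit Types (f g : nat -> R).

Lemma rsum_0 f : rsum 0 f = 0.
Proof. reflexivity. Qed.

Lemma rsum_S n f : rsum (S n) f = rsum n f + f n.
Proof. unfold rsum; rewrite seq_S, lsum_app, lsum_cons, lsum_nil; simpl; ring. Qed.

Lemma rsum_ext n f g : (forall i, (i < n)%nat -> f i = g i) -> rsum n f = rsum n g.
Proof. intros H; apply lsum_ext; intros i Hi; apply in_seq in Hi; apply H; lia. Qed.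

Lemma rsum_le n f g : (forall i, (i < n)%nat -> f i <= g i) -> rsum n f <= rsum n g.
Proof. intros H; apply lsum_le; intros i Hi; apply in_seq in Hi; apply H; lia. Qed.

Lemma rsum_nonneg n f : (forall i, (i < n)%nat -> 0 <= f i) -> 0 <= rsum n f.
Proof. intros H; apply lsum_nonneg; intros i Hi; apply in_seq in Hi; apply H; lia. Qed.

Lemma rsum_plus n f g : rsum n (fun i => f i + g i) = rsum n f + rsum n g.
Proof. apply lsum_plus. Qed.

Lemma rsum_minus n f g : rsum n (fun i => f i - g i) = rsum n f - rsum n g.
Proof. apply lsum_minus. Qed.

Lemma rsum_scal n c f : rsum n (fun i => c * f i) = c * rsum n f.
Proof. apply lsum_scal. Qed.

Lemma rsum_scal_r n c f : rsum n (fun i => f i * c) = rsum n f * c.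
Proof. apply lsum_scal_r. Qed.

Lemma rsum_zero n : rsum n (fun _ => 0) = 0.
Proof. apply lsum_zero. Qed.

Lemma rsum_const n c : rsum n (fun _ => c) = INR n * c.
Proof. unfold rsum; now rewrite lsum_const, length_seq. Qed.

Lemma rsum_swap n m (F : nat -> nat -> R) :
  rsum n (fun i => rsum m (fun j => F i j)) = rsum m (fun j => rsum n (fun i => F i j)).
Proof. apply lsum_swap. Qed.

Lemma rsum_lsum_swap {T} n (l : list T) (F : nat -> T -> R) :
  rsum n (fun i => lsum l (fun a => F i a)) = lsum l (fun a => rsum n (fun i => F i a)).
Proof. apply lsum_swap. Qed.

Lemma rsum_nonneg_eq0 n f i :
  (forall i, (i < n)%nat -> 0 <= f i) -> rsum n f = 0 -> (i < n)%nat -> f i = 0.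
Proof.
intros H H0 Hi; apply (lsum_nonneg_eq0 (seq 0 n)); auto.
- intros a Ha; apply in_seq in Ha; apply H; lia.
- apply in_seq; lia.
Qed.

Lemma rsum_split n m f : rsum (n + m) f = rsum n f + rsum m (fun i => f (n + i)%nat).
Proof.
induction m as [|m IH]; [rewrite Nat.add_0_r, rsum_0; ring|].
rewrite Nat.add_succ_r, !rsum_S, IH; ring.
Qed.

Lemma rsum_delta n f j : (j < n)%nat -> rsum n (fun i => if Nat.eqb i j then f i else 0) = f j.
Proof.
induction n as [|n IH]; intros Hj; [lia|].
rewrite rsum_S; destruct (Nat.eqb_spec n j) as [->|Hn].
- rewrite (rsum_ext _ _ (fun _ => 0)), rsum_zero; [ring|].
  intros i Hi; destruct (Nat.eqb_spec i j); [lia|reflexivity].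
- rewrite IH by lia; ring.
Qed.

Lemma rsum_delta_l n f j : (j < n)%nat -> rsum n (fun i => if Nat.eqb j i then f i else 0) = f j.
Proof.
intros Hj; rewrite <- (rsum_delta n f j Hj); apply rsum_ext; intros i _.
now rewrite Nat.eqb_sym.
Qed.

End IndexSums.

(** * The real spectral theorem *)

Definition dot (m : nat) (u v : nat -> R) : R := rsum m (fun i => u i * v i).
Definition mv (m : nat) (X : Mat) (u : nat -> R) : nat -> R := fun i => rsum m (fun j => X i j * u j).
Definition msym (m : nat) (X : Mat) : Prop := meq m X (mtr X).

(* [e i], for [i < m], is an orthonormal basis of eigenvectors of [X] with eigenvalues [x i];
   the two orthogonality relations are [Q^T Q = 1] and [Q Q^T = 1]. *)
Definition spec (m : nat) (X : Mat) (e : nat -> nat -> R) (x : nat -> R) : Prop :=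
  (forall i j, (i < m)%nat -> (j < m)%nat -> dot m (e i) (e j) = if Nat.eqb i j then 1 else 0) /\
  (forall k l, (k < m)%nat -> (l < m)%nat ->
     rsum m (fun i => e i k * e i l) = if Nat.eqb k l then 1 else 0) /\
  (forall i k, (i < m)%nat -> (k < m)%nat -> mv m X (e i) k = x i * e i k).

Module RealSpectral.
Import all_boot all_order all_algebra complex ring Rstruct.
Import GRing.Theory Order.Theory Num.Theory.
Local Open Scope ring_scope.
Local Open Scope sesquilinear_scope.

(** An eigenvalue [c] exists over the complex closure; for its eigenvector [z], the number [z A z^*]
    equals [c |z|^2] and its own conjugate, so [c] is real. It is then a root of the characteristic
    polynomial of [A] itself, which provides a real eigenvector. *)
Lemma symmetric_real_eigenvector (R : rcfType) (n : nat) (A : 'M[R]_n.+1) :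
  A^T = A -> exists (a : R) (v : 'rV[R]_n.+1), v != 0 /\ v *m A = a *: v.
Proof.
move=> symA.
pose f := real_complex R.
have [c c_eig] := @eigenvalue_closed (R[i]) n.+1 (map_mx f A) isT.
have cR : c \is Num.real.
  have /eigenvalueP [z zA z0] := c_eig.
  have zz0 : (z *m z ^t*) 0 0 != 0.
    by rewrite -dotmxE dnorm_eq0.
  rewrite CrealE; apply/eqP; apply: (mulIf zz0).
  have e1 : z *m map_mx f A *m z ^t* = c *: (z *m z ^t*) by rewrite zA scalemxAl.
  have fA : (map_mx f A) ^t* = map_mx f A.
    apply/matrixP => i j; rewrite !mxE -{2}symA mxE.
    exact: conjc_real.
  have e2 : z *m (z ^t* ) = (z *m (z ^t* )) ^t*.
    by rewrite trmx_mul map_mxM /= trmxCK.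
  have e3 : z *m map_mx f A *m z ^t* = (z *m map_mx f A *m z ^t*) ^t*.
    by rewrite !trmx_mul !map_mxM /= trmxCK fA mulmxA.
  move: e3; rewrite e1 => /matrixP/(_ 0 0).
  rewrite [in RHS]linearZ /= map_mxZ -e2 => /esym.
  by rewrite [in LHS]mxE [in RHS]mxE.
have [a ca] : exists a, c = f a by exists (complex.Re c); rewrite /f RRe_real.
have : eigenvalue A a.
  have : root (char_poly (map_mx f A)) (f a) by rewrite -ca -eigenvalue_root_char.
  by rewrite -map_char_poly fmorph_root -eigenvalue_root_char.
by move=> /eigenvalueP [v vA v0]; exists a, v.
Qed.

Lemma row_sqnormE (R : rcfType) (n : nat) (v : 'rV[R]_n) :
  (v *m v^T) 0 0 = \sum_i v 0 i ^+ 2.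
Proof. by rewrite mxE; apply: eq_bigr => i _; rewrite mxE expr2. Qed.

Lemma row_sqnorm_eq0 (R : rcfType) (n : nat) (v : 'rV[R]_n) :
  ((v *m v^T) 0 0 == 0) = (v == 0).
Proof.
rewrite row_sqnormE psumr_eq0; last by move=> i _; apply: sqr_ge0.
apply/allP/eqP => [h|-> i _]; last by rewrite mxE expr0n /= eqxx.
apply/rowP => i; rewrite mxE; apply/eqP; rewrite -sqrf_eq0.
exact: (h i (mem_index_enum i)).
Qed.

(** The reflection in the hyperplane orthogonal to [u - e] exchanges the unit vectors [u] and [e].
    With [t = <u, e>] one has [|u - e|^2 = 2 - 2 t], whence the coefficient [r]; for [u = e] the
    identity serves. *)
Lemma householder (R : rcfType) (n : nat) (u : 'rV[R]_n.+1) :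
  u *m u^T = 1%:M -> exists H : 'M[R]_n.+1, [/\ H^T = H, H *m H = 1%:M & u *m H = delta_mx 0 0].
Proof.
move=> u1; pose e : 'rV[R]_n.+1 := delta_mx 0 0.
have e1 : e *m e^T = 1%:M.
  by rewrite /e trmx_delta mul_delta_mx; apply/matrixP=> i j; rewrite !ord1 !mxE.
have [->|ue] := eqVneq u e.
  by exists 1%:M; rewrite trmx1 !mulmx1.
pose w := u - e.
pose t := (u *m e^T) 0 0.
have uet : u *m e^T = t%:M by rewrite [LHS]mx11_scalar.
have eut : e *m u^T = t%:M by rewrite -[LHS]trmxK trmx_mul trmxK uet tr_scalar_mx.
have ww : w *m w^T = (2 - 2 * t)%:M.
  rewrite /w linearB /= mulmxBl !mulmxBr u1 e1 uet eut.
  by apply/matrixP=> i j; rewrite !ord1 !mxE eqxx !mulr1n; ring.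
have t1 : 2 - 2 * t != 0.
  apply/eqP => t0; have : w != 0 by rewrite subr_eq0.
  by rewrite -row_sqnorm_eq0 ww t0 mxE mul0rn eqxx.
pose r := 2 / (2 - 2 * t).
exists (1%:M - r *: (w^T *m w)); split.
- by rewrite linearB /= trmx1 linearZ /= trmx_mul trmxK.
- rewrite mulmxBl !(mulmxBr _ 1%:M) !mul1mx mulmx1 -scalemxAl -scalemxAr.
  have -> : w^T *m w *m (w^T *m w) = (2 - 2 * t) *: (w^T *m w).
    by rewrite mulmxA -(mulmxA w^T w) ww mul_mx_scalar scalemxAl.
  rewrite !scalerA opprB addrA -[RHS]addr0 -!addrA; congr (_ + _).
  rewrite -!scaleNr -!scalerDl [X in X *: _](_ : _ = 0) ?scale0r //.
  by rewrite /r; field.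
- rewrite (mulmxBr _ 1%:M) mulmx1 -scalemxAr mulmxA.
  have -> : u *m w^T = (1 - t)%:M.
    rewrite /w linearB /= mulmxBr u1 uet.
    by apply/matrixP=> i j; rewrite !ord1 !mxE eqxx !mulr1n.
  rewrite mul_scalar_mx scalerA [X in X *: _](_ : _ = 1).
    by rewrite scale1r /w opprB addrC subrK.
  by rewrite /r; field.
Qed.

(** Deflation: a reflection moves a unit eigenvector to the first basis vector, so the first row of
    the conjugated matrix vanishes off the diagonal. By symmetry so does the first column, and
    induction applies to the remaining block. *)
Lemma symmetric_spectral (R : rcfType) (n : nat) (A : 'M[R]_n) : A^T = A ->
  exists (Q : 'M[R]_n) (l : 'rV[R]_n), Q^T *m Q = 1%:M /\ A = Q *m diag_mx l *m Q^T.
Proof.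
elim: n A => [|n IHn] A symA.
  by exists 1%:M, 0; split; apply/matrixP=> -[].
have [a [v [v0 vA]]] := symmetric_real_eigenvector _ _ _ symA.
pose s := (v *m v^T) 0 0.
have s0 : 0 < s.
  rewrite lt_def /s row_sqnorm_eq0 v0 row_sqnormE.
  by apply: sumr_ge0 => i _; apply: sqr_ge0.
pose u := (Num.sqrt s)^-1 *: v.
have u1 : u *m u^T = 1%:M.
  rewrite /u linearZ /= -scalemxAl -scalemxAr scalerA [X in _ *: X]mx11_scalar -/s.
  rewrite scale_scalar_mx -invfM -expr2 sqr_sqrtr ?ltW // mulVf //; exact: lt0r_neq0.
have uA : u *m A = a *: u by rewrite /u -scalemxAl vA !scalerA mulrC.
have [H [symH HH uH]] := householder _ _ _ u1.
have eH : delta_mx 0 0 *m H = u by rewrite -uH -mulmxA HH mulmx1.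
have [B [symB rowB EA]] :
    exists B : 'M_(1 + n), [/\ B^T = B, row 0 B = a *: delta_mx 0 0 & A = H *m B *m H].
  exists (H *m A *m H); split; first by rewrite !trmx_mul symH symA mulmxA.
    by rewrite rowE !mulmxA eH uA -scalemxAl uH.
  by rewrite !mulmxA HH mul1mx -mulmxA HH mulmx1.
have B0 : ursubmx B = 0.
  apply/matrixP=> i j; rewrite [RHS]mxE ord1.
  have /rowP/(_ (rshift 1 j)) := rowB; rewrite [LHS]mxE [RHS]mxE [X in _ * X]mxE /= mulr0 => <-.
  by rewrite 2!mxE; congr (B _ _); apply/val_inj.
have B0' : dlsubmx B = 0 by rewrite -symB -trmx_ursub B0 trmx0.
have [|Q [l [QQ EQ]]] := IHn (drsubmx B); first by rewrite trmx_drsub symB.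
pose P := block_mx 1%:M 0 0 Q : 'M_(1 + n).
have EB : B = P *m diag_mx (row_mx (ulsubmx B) l) *m P^T.
  rewrite -[LHS]submxK B0 B0' EQ diag_mx_row /P tr_block_mx !mulmx_block.
  rewrite !(trmx0, trmx1, mul0mx, mulmx0, mul1mx, mulmx1, addr0, add0r).
  by congr (block_mx _ _ _ _); apply/matrixP=> i j; rewrite !ord1 !mxE eqxx.
have PP : P^T *m P = 1%:M.
  rewrite /P tr_block_mx mulmx_block.
  by rewrite !(trmx0, trmx1, mul0mx, mulmx0, mul1mx, addr0, add0r) QQ -scalar_mx_block.
exists (H *m P), (row_mx (ulsubmx B) l); split.
  by rewrite trmx_mul symH mulmxA -(mulmxA _ H H) HH mulmx1.
rewrite trmx_mul symH !mulmxA -(mulmxA H P) -(mulmxA H _ P^T).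
by rewrite -EB.
Qed.

Lemma rsum_bigE (n : nat) (f : nat -> R) : rsum n f = \sum_(i < n) f i.
Proof.
elim: n => [|n IH]; first by rewrite big_ord0.
by rewrite rsum_S big_ord_recr /= IH.
Qed.

Lemma eqb_ordE (m : nat) (i j : 'I_m) : (if Nat.eqb i j then 1%R else 0%R) = (i == j)%:R :> R.
Proof.
rewrite (_ : Nat.eqb i j = (i == j)); first by case: (i == j).
by apply/PeanoNat.Nat.eqb_spec/eqP => [/val_inj|->].
Qed.

Lemma spectral_theorem (m : nat) (X : Mat) : msym m X -> exists e x, spec m X e x.
Proof.
move=> symX; pose A : 'M[R]_m := \matrix_(i, j) X i j.
have symA : A^T = A.
  by apply/matrixP=> i j; rewrite !mxE; apply: symX; apply/ssrnat.ltP; exact: ltn_ord.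
have [Q [l [QQ AE]]] := symmetric_spectral _ _ _ symA.
have QQ' : Q *m Q^T = 1%:M by apply: mulmx1C.
have AQ : A *m Q = Q *m diag_mx l by rewrite AE -[LHS]mulmxA QQ mulmx1.
pose e (i k : nat) : R := if insub i is Some i' then if insub k is Some k' then Q k' i' else 0 else 0.
pose x (i : nat) : R := if insub i is Some i' then l 0 i' else 0.
have eE (i k : 'I_m) : e i k = Q k i by rewrite /e !valK.
have xE (i : 'I_m) : x i = l 0 i by rewrite /x valK.
exists e, x; split; [|split].
- move=> i j /ssrnat.ltP Hi /ssrnat.ltP Hj; rewrite /dot rsum_bigE.
  have /matrixP/(_ (Ordinal Hi) (Ordinal Hj)) := QQ; rewrite !mxE -eqb_ordE => <-.
  by apply: eq_bigr => k _; rewrite mxE -!eE.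
- move=> i j /ssrnat.ltP Hi /ssrnat.ltP Hj; rewrite rsum_bigE.
  have /matrixP/(_ (Ordinal Hi) (Ordinal Hj)) := QQ'; rewrite !mxE -eqb_ordE => <-.
  by apply: eq_bigr => k _; rewrite mxE -!eE.
- move=> i k /ssrnat.ltP Hi /ssrnat.ltP Hk; rewrite /mv rsum_bigE.
  have /matrixP/(_ (Ordinal Hk) (Ordinal Hi)) := AQ.
  rewrite mul_mx_diag mxE [in RHS]mxE -eE -xE /= => E.
  rewrite Rmult_comm; apply: etrans E; apply: eq_bigr => j _.
  by rewrite -eE mxE.
Qed.

(** A left inverse of a square matrix is a right inverse: [orthogonal] provides [Q^T Q = 1], and
    [spec] also asks for [Q Q^T = 1]. *)
Lemma orthonormal_complete (m : nat) (Q : Mat) : Defs.orthogonal m Q ->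
  forall k l, (k < m)%coq_nat -> (l < m)%coq_nat -> rsum m (fun i => Rmult (Q k i) (Q l i)) = (if Nat.eqb k l then 1%R else 0%R).
Proof.
move=> orthQ k l /ssrnat.ltP Hk /ssrnat.ltP Hl.
pose P : 'M[R]_m := \matrix_(i, j) Q i j.
have PP : P^T *m P = 1%:M.
  apply/matrixP => i j.
  have := orthQ i j (ssrnat.ltP (ltn_ord i)) (ssrnat.ltP (ltn_ord j)).
  rewrite /mmul /mdiag /mtr rsum_bigE !mxE -eqb_ordE => <-.
  by apply: eq_bigr => r _; rewrite !mxE.
have /matrixP/(_ (Ordinal Hk) (Ordinal Hl)) := mulmx1C PP; rewrite !mxE -eqb_ordE => <-.
by rewrite rsum_bigE; apply: eq_bigr => r _; rewrite !mxE.
Qed.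
End RealSpectral.

(** * Real powers *)

Lemma rpow_pos x y : 0 < x -> rpow x y = exp (y * ln x).
Proof. intros H; unfold rpow; destruct (Rle_dec x 0); [lra|reflexivity]. Qed.

Lemma rpow_npos x y : x <= 0 -> rpow x y = 0.
Proof. intros H; unfold rpow; destruct (Rle_dec x 0); [reflexivity|lra]. Qed.

Lemma rpow_gt0 x y : 0 < x -> 0 < rpow x y.
Proof. intros H; rewrite rpow_pos by auto; apply exp_pos. Qed.

Lemma rpow_ge0 x y : 0 <= rpow x y.
Proof.
destruct (Rle_dec x 0); [rewrite rpow_npos; lra|].
left; apply rpow_gt0; lra.
Qed.

Lemma rpow_plus x a b : rpow x (a + b) = rpow x a * rpow x b.
Proof.
destruct (Rle_dec x 0); [rewrite !rpow_npos; lra|].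
rewrite !rpow_pos by lra; rewrite <- exp_plus; f_equal; ring.
Qed.

Lemma rpow_mult x a b : rpow (rpow x a) b = rpow x (a * b).
Proof.
destruct (Rle_dec x 0); [rewrite !(rpow_npos x) by auto; apply rpow_npos; lra|].
rewrite (rpow_pos (rpow x a)) by (apply rpow_gt0; lra).
rewrite !(rpow_pos x) by lra; rewrite ln_exp; f_equal; ring.
Qed.

Lemma rpow_1 x : 0 <= x -> rpow x 1 = x.
Proof.
intros [H| <-]; [|apply rpow_npos; lra].
rewrite rpow_pos, Rmult_1_l by auto; now apply exp_ln.
Qed.

Lemma rpow_mul x y a : 0 <= x -> 0 <= y -> rpow (x * y) a = rpow x a * rpow y a.
Proof.
intros [Hx| <-]; [|intros _; rewrite Rmult_0_l, !(rpow_npos 0); lra].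
intros [Hy| <-]; [|rewrite Rmult_0_r, !(rpow_npos 0); lra].
rewrite !rpow_pos by auto using Rmult_lt_0_compat.
rewrite ln_mult, <- exp_plus by auto; f_equal; ring.
Qed.

Lemma rpow_succ x s : 0 <= x -> x * rpow x s = rpow x (s + 1).
Proof. intros H; rewrite rpow_plus, rpow_1 by auto; ring. Qed.

Lemma rpow_pred x s : 0 <= x -> x * rpow x (s - 1) = rpow x s.
Proof. intros H; rewrite rpow_succ by auto; f_equal; ring. Qed.

Lemma exp_le x y : x <= y -> exp x <= exp y.
Proof. intros [H| ->]; [left; now apply exp_increasing|lra]. Qed.

Lemma rpow_le x y a : 0 <= a -> x <= y -> rpow x a <= rpow y a.
Proof.
intros Ha H; destruct (Rle_dec x 0); [rewrite (rpow_npos x) by auto; apply rpow_ge0|].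
rewrite !rpow_pos by lra; apply exp_le, Rmult_le_compat_l; auto.
destruct H as [H| ->]; [left; apply ln_increasing; lra|lra].
Qed.

Lemma rpow_le_neg x y a : a <= 0 -> 0 < x -> x <= y -> rpow y a <= rpow x a.
Proof.
intros Ha Hx H; rewrite !rpow_pos by lra; apply exp_le.
assert (ln x <= ln y) by (destruct H as [H| ->]; [left; apply ln_increasing; lra|lra]).
nra.
Qed.

(** The tangent at [th * x] lies below [exp] at [x] and at [0]; the two bounds are averaged with
    weights [th] and [1 - th]. *)
Lemma exp_convex th x : 0 <= th <= 1 -> exp (th * x) <= th * exp x + (1 - th).
Proof.
intros Hth.
assert (H1 := exp_ineq1_le (x - th * x)); assert (H2 := exp_ineq1_le (- (th * x))).
assert (E1 : exp x = exp (th * x) * exp (x - th * x)) by (rewrite <- exp_plus; f_equal; ring).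
assert (E2 : 1 = exp (th * x) * exp (- (th * x))) by (rewrite <- exp_plus, <- exp_0; f_equal; ring).
assert (P := exp_pos (th * x)).
rewrite E1; set (m := exp (th * x)) in *.
replace (1 - th) with ((1 - th) * (m * exp (- (th * x)))) by (rewrite <- E2; ring).
assert (th * (1 + (x - th * x)) <= th * exp (x - th * x)) by (apply Rmult_le_compat_l; lra).
assert ((1 - th) * (1 + - (th * x)) <= (1 - th) * exp (- (th * x))) by (apply Rmult_le_compat_l; lra).
nra.
Qed.

(** The conjugate exponent [q / (q - 1)] is never written, which keeps [q = 1], that is [p = 2],
    admissible. For positive [a] and [b] this is convexity of [exp] between [q ln b] and
    [q ln a]. *)
Lemma young a b q : 1 <= q -> 0 <= a -> 0 <= b ->
  a * rpow b (q - 1) <= rpow a q / q + (q - 1) / q * rpow b q.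
Proof.
intros Hq Ha Hb.
assert (Ra : 0 <= rpow a q / q).
{ apply Rmult_le_pos; [apply rpow_ge0|]; left; apply Rinv_0_lt_compat; lra. }
assert (Rb : 0 <= (q - 1) / q * rpow b q).
{ apply Rmult_le_pos; [|apply rpow_ge0].
  apply Rmult_le_pos; [lra|]; left; apply Rinv_0_lt_compat; lra. }
destruct Ha as [Ha| <-]; [|lra].
destruct Hb as [Hb| <-]; [|rewrite (rpow_npos 0 (q - 1)); lra].
assert (H := exp_convex (1 / q) (q * (ln a - ln b))).
rewrite !rpow_pos by auto.
assert (Ea : a = exp (ln a)) by (symmetry; now apply exp_ln).
rewrite Ea at 1; rewrite <- exp_plus.
replace (ln a + (q - 1) * ln b) with (1 / q * (q * (ln a - ln b)) + q * ln b) by (field; lra).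
replace (q * ln a) with (q * (ln a - ln b) + q * ln b) by ring.
rewrite !exp_plus.
replace ((q - 1) / q) with (1 - 1 / q) by (field; lra).
assert (0 <= 1 / q <= 1).
{ split; [apply Rmult_le_pos; [lra|left; apply Rinv_0_lt_compat; lra]|].
  apply Rmult_le_reg_r with q; [lra|]; field_simplify; lra. }
assert (P := exp_pos (q * ln b)).
apply Rle_trans with ((1 / q * exp (q * (ln a - ln b)) + (1 - 1 / q)) * exp (q * ln b)).
- apply Rmult_le_compat_r; [lra|auto].
- apply Req_le; field; lra.
Qed.

(** The difference quotient of a convex power is at most the derivative at the larger point; adding
    both derivatives makes the bound symmetric. The tangent inequality [main] is Young's inequality
    rearranged. *)
Lemma rpow_klein s x y : 1 <= s -> 0 <= x -> 0 <= y ->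
  (x - y) * (rpow x s - rpow y s) <= (x - y) * (x - y) * (s * rpow x (s - 1) + s * rpow y (s - 1)).
Proof.
assert (main : forall x y, 1 <= s -> 0 <= x -> 0 <= y ->
   rpow x s - rpow y s <= (x - y) * (s * rpow x (s - 1))).
{ intros a b Hs Ha Hb.
  assert (Y := young b a s Hs Hb Ha).
  assert (Y2 : s * (b * rpow a (s - 1)) <= s * (rpow b s / s + (s - 1) / s * rpow a s)) by (apply Rmult_le_compat_l; lra).
  replace (s * (rpow b s / s + (s - 1) / s * rpow a s)) with (rpow b s + (s - 1) * rpow a s) in Y2 by (field; lra).
  assert (E := rpow_pred a s Ha).
  replace ((a - b) * (s * rpow a (s - 1))) with (s * (a * rpow a (s - 1)) - s * (b * rpow a (s - 1))) by ring.
  rewrite E; lra. }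
intros Hs Hx Hy.
assert (M1 := main x y Hs Hx Hy); assert (M2 := main y x Hs Hy Hx).
assert (P1 := rpow_ge0 x (s - 1)); assert (P2 := rpow_ge0 y (s - 1)).
assert (Px : 0 <= s * rpow x (s - 1)) by (apply Rmult_le_pos; lra).
assert (Py : 0 <= s * rpow y (s - 1)) by (apply Rmult_le_pos; lra).
set (a := s * rpow x (s - 1)) in *; set (b := s * rpow y (s - 1)) in *.
assert (Sq := Rle_0_sqr (x - y)); unfold Rsqr in Sq.
assert (0 <= (x - y) * (x - y) * a) by now apply Rmult_le_pos.
assert (0 <= (x - y) * (x - y) * b) by now apply Rmult_le_pos.
destruct (Rle_dec y x).
- assert ((x - y) * (rpow x s - rpow y s) <= (x - y) * ((x - y) * a)) by (apply Rmult_le_compat_l; lra).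
  lra.
- assert ((y - x) * (rpow y s - rpow x s) <= (y - x) * ((y - x) * b)) by (apply Rmult_le_compat_l; lra).
  lra.
Qed.

Definition spow (x s : R) : R := if Rle_dec 0 x then rpow x s else - rpow (- x) s.

Lemma spow_klein s x y : 1 <= s ->
  (x - y) * (spow x s - spow y s) <=
  (x - y) * (x - y) * (s * rpow (Rabs x) (s - 1) + s * rpow (Rabs y) (s - 1)).
Proof.
intros Hs; unfold spow.
(* For opposite signs it suffices that [a^s = a a^(s-1) <= (a + b) a^(s-1)], and likewise for
   [b]. *)
assert (opp : forall a b, 0 <= a -> 0 <= b ->
  (a + b) * (rpow a s + rpow b s) <= (a + b) * (a + b) * (s * rpow a (s - 1) + s * rpow b (s - 1))).
{ intros a b Ha Hb.
  rewrite <- (rpow_pred a s Ha), <- (rpow_pred b s Hb).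
  assert (A := rpow_ge0 a (s - 1)); assert (B := rpow_ge0 b (s - 1)).
  set (u := rpow a (s - 1)) in *; set (v := rpow b (s - 1)) in *.
  rewrite Rmult_assoc; apply Rmult_le_compat_l; [lra|].
  assert (a * u <= (a + b) * u) by nra. assert (b * v <= (a + b) * v) by nra.
  assert (0 <= (a + b) * u) by nra. assert (0 <= (a + b) * v) by nra.
  nra. }
destruct (Rle_dec 0 x) as [Hx|Hx], (Rle_dec 0 y) as [Hy|Hy].
- rewrite !Rabs_pos_eq by auto; now apply rpow_klein.
- rewrite Rabs_pos_eq, (Rabs_left y) by lra.
  assert (O := opp x (- y)). replace (x - y) with (x + - y) by ring.
  replace (rpow x s - - rpow (- y) s) with (rpow x s + rpow (- y) s) by ring; apply O; lra.
- rewrite (Rabs_left x), (Rabs_pos_eq y) by lra.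
  assert (O := opp (- x) y).
  replace ((x - y) * (- rpow (- x) s - rpow y s)) with ((- x + y) * (rpow (- x) s + rpow y s)) by ring.
  replace ((x - y) * (x - y)) with ((- x + y) * (- x + y)) by ring; apply O; lra.
- rewrite !Rabs_left by lra.
  assert (K := rpow_klein s (- x) (- y) Hs).
  replace ((x - y) * (- rpow (- x) s - - rpow (- y) s)) with ((- x - - y) * (rpow (- x) s - rpow (- y) s)) by ring.
  replace ((x - y) * (x - y)) with ((- x - - y) * (- x - - y)) by ring; apply K; lra.
Qed.

Lemma mult_spow x s : x * spow x s = rpow (Rabs x) (s + 1).
Proof.
unfold spow; destruct (Rle_dec 0 x).
- rewrite Rabs_pos_eq by auto; now apply rpow_succ.
- rewrite Rabs_left by lra; rewrite <- rpow_succ by lra; ring.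
Qed.

(* For [0 <= s <= 1] the value [0^(s-1) = 0] of [rpow] makes the hypothesis [0 < x] necessary. *)
Lemma rpow_klein_concave s x y : s <= 1 -> 0 < x -> 0 <= y ->
  (x - y) * (rpow x s - rpow y s) <= (x - y) * (x - y) * rpow x (s - 1).
Proof.
intros Hs Hx Hy.
rewrite <- (rpow_pred x s) by lra; rewrite <- (rpow_pred y s) by lra.
assert (P := rpow_gt0 x (s - 1) Hx).
destruct Hy as [Hy| <-]; [|nra].
(* [x^s - y^s = (x - y) x^(s-1) - y (y^(s-1) - x^(s-1))], and the last bracket has the sign of
   [x - y] because [t^(s-1)] decreases. *)
assert (0 <= (x - y) * (rpow y (s - 1) - rpow x (s - 1))).
{ destruct (Rle_dec x y).
  - assert (Hm := rpow_le_neg x y (s - 1)). nra.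
  - assert (Hm := rpow_le_neg y x (s - 1)). nra. }
nra.
Qed.

(** After division by [b^(s+1)] this is [(b/z)^(1-s) <= (1-s) (b/z) + s]. The bound is affine in
    [1/z], so averaging it over the spectrum of [Z] leaves only a quadratic form of [Z^-1] to
    control. *)
Lemma rpow_concave_young s b z : 0 <= s <= 1 -> 0 < b -> 0 < z ->
  b * b * rpow z (s - 1) <= rpow b (s + 1) * ((1 - s) * (b / z) + s).
Proof.
intros Hs Hb Hz.
assert (H := exp_convex (1 - s) (ln b - ln z)).
rewrite !rpow_pos by auto.
assert (Eb : b = exp (ln b)) by (symmetry; now apply exp_ln).
assert (Ez : / z = exp (- ln z)) by (rewrite exp_Ropp, exp_ln; auto).
replace (b * b * exp ((s - 1) * ln z)) with (exp ((s + 1) * ln b) * exp ((1 - s) * (ln b - ln z))).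
- apply Rmult_le_compat_l; [left; apply exp_pos|].
  unfold Rdiv; rewrite Ez; rewrite Eb at 2; rewrite <- exp_plus.
  replace s with (1 - (1 - s)) at 3 by ring; apply H; lra.
- rewrite Eb at 3 4; rewrite <- !exp_plus; f_equal; ring.
Qed.

(** * Traces in two eigenbases *)

Lemma dot_ext m u u' v v' : (forall k, (k < m)%nat -> u k = u' k) ->
  (forall k, (k < m)%nat -> v k = v' k) -> dot m u v = dot m u' v'.
Proof. intros Hu Hv; apply rsum_ext; intros k Hk; now rewrite Hu, Hv. Qed.

Lemma dot_comm m u v : dot m u v = dot m v u.
Proof. apply rsum_ext; intros; ring. Qed.

Lemma dot_scal_l m c u v : dot m (fun k => c * u k) v = c * dot m u v.
Proof. unfold dot; rewrite <- rsum_scal; apply rsum_ext; intros; ring. Qed.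

Lemma dot_minus_l m u u' v : dot m (fun k => u k - u' k) v = dot m u v - dot m u' v.
Proof. unfold dot; rewrite <- rsum_minus; apply rsum_ext; intros; ring. Qed.

Lemma dot_rsum_l m n (U : nat -> nat -> R) v :
  dot m (fun k => rsum n (fun j => U j k)) v = rsum n (fun j => dot m (U j) v).
Proof.
unfold dot; rewrite <- rsum_swap; apply rsum_ext; intros k _.
now rewrite <- rsum_scal_r.
Qed.

Lemma dot_self_ge0 m u : 0 <= dot m u u.
Proof. apply rsum_nonneg; intros; apply Rle_0_sqr. Qed.

Lemma mv_selfadjoint m X u v : msym m X -> dot m (mv m X u) v = dot m u (mv m X v).
Proof.
intros HX; unfold dot, mv.
rewrite (rsum_ext m _ (fun i => rsum m (fun j => X i j * u j * v i)))
  by (intros; now rewrite <- rsum_scal_r).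
rewrite rsum_swap; apply rsum_ext; intros j Hj.
rewrite <- rsum_scal; apply rsum_ext; intros i Hi.
rewrite (HX i j Hi Hj); unfold mtr; ring.
Qed.

Definition bil (m : nat) (G : Mat) (u v : nat -> R) : R := dot m u (mv m G v).
Definition msq (m : nat) (X : Mat) : Mat := mmul m X X.
Definition psd (m : nat) (X : Mat) : Prop := forall u, 0 <= bil m X u u.

Lemma mv_mmul m X Y u k : mv m (mmul m X Y) u k = mv m X (mv m Y u) k.
Proof.
unfold mv, mmul.
rewrite (rsum_ext m _ (fun j => rsum m (fun l => X k l * Y l j * u j)))
  by (intros; now rewrite <- rsum_scal_r).
rewrite rsum_swap; apply rsum_ext; intros l _.
rewrite <- rsum_scal; apply rsum_ext; intros; ring.
Qed.

Lemma msym_msq m X : msym m X -> msym m (msq m X).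
Proof.
intros HX i j Hi Hj; apply rsum_ext; intros l Hl.
rewrite (HX i l), (HX l j) by auto; unfold mtr; ring.
Qed.

Lemma bil_msq m X u : msym m X -> bil m (msq m X) u u = dot m (mv m X u) (mv m X u).
Proof.
intros HX; rewrite (mv_selfadjoint m X u) by auto.
apply dot_ext; auto; intros; apply mv_mmul.
Qed.

Lemma psd_msq m X : msym m X -> psd m (msq m X).
Proof. intros HX u; rewrite bil_msq by auto; apply dot_self_ge0. Qed.

Section TwoEigenbases.
Variables (m : nat) (X Y : Mat) (e v : nat -> nat -> R) (x y : nat -> R).
Hypotheses (symX : msym m X) (symY : msym m Y) (specX : spec m X e x) (specY : spec m Y v y).

Lemma spec_parseval a b : dot m a b = rsum m (fun i => dot m a (e i) * dot m b (e i)).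
Proof.
destruct specX as (_ & complete & _).
transitivity (rsum m (fun i => rsum m (fun k => rsum m (fun l => a k * b l * (e i k * e i l))))).
2:{ apply rsum_ext; intros i _; unfold dot; rewrite <- rsum_scal_r; apply rsum_ext; intros k _.
    rewrite <- rsum_scal; apply rsum_ext; intros; ring. }
rewrite rsum_swap; apply rsum_ext; intros k Hk.
rewrite rsum_swap.
rewrite (rsum_ext m _ (fun l => if Nat.eqb k l then a k * b l else 0)).
- now rewrite (rsum_delta_l m (fun l => a k * b l)).
- intros l Hl; rewrite rsum_scal, complete by auto; destruct (Nat.eqb k l); ring.
Qed.

Lemma spec_mv_dot u i : (i < m)%nat -> dot m (mv m X u) (e i) = x i * dot m u (e i).
Proof.
intros Hi; destruct specX as (_ & _ & eig).
rewrite mv_selfadjoint by auto; rewrite (dot_comm m u (e i)), <- dot_scal_l, dot_comm.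
apply dot_ext; auto.
Qed.

Lemma spec_bil u : bil m X u u = rsum m (fun i => x i * (dot m u (e i) * dot m u (e i))).
Proof.
unfold bil; rewrite spec_parseval; apply rsum_ext; intros i Hi.
rewrite spec_mv_dot by auto; ring.
Qed.

Lemma spec_norm i : (i < m)%nat -> dot m (e i) (e i) = 1.
Proof. intros Hi; destruct specX as (orth & _); now rewrite orth, Nat.eqb_refl. Qed.

Lemma spec_bil_diag i : (i < m)%nat -> bil m X (e i) (e i) = x i.
Proof.
intros Hi; unfold bil; rewrite <- mv_selfadjoint, spec_mv_dot, spec_norm by auto; ring.
Qed.

End TwoEigenbases.

(** With [overlap_col_sum]: the squared overlaps of two orthonormal bases form a doubly stochastic
    matrix, so a function of [x i] alone or of [y j] alone can be spread over a double sum. *)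
Lemma overlap_row_sum m X Y e v x y i : spec m X e x -> spec m Y v y -> (i < m)%nat ->
  rsum m (fun j => dot m (e i) (v j) * dot m (e i) (v j)) = 1.
Proof.
intros HX HY Hi; rewrite <- (spec_parseval m Y v y HY); now apply (spec_norm m X e x).
Qed.

Lemma overlap_col_sum m X Y e v x y j : spec m X e x -> spec m Y v y -> (j < m)%nat ->
  rsum m (fun i => dot m (e i) (v j) * dot m (e i) (v j)) = 1.
Proof.
intros HX HY Hj; rewrite <- (overlap_row_sum m Y X v e y x j HY HX Hj).
apply rsum_ext; intros i _; now rewrite (dot_comm m (e i)).
Qed.

(** Eigenvectors for different eigenvalues are orthogonal, so the overlap weights live on pairs with
    [x i = y j], where [f (x i)] and [f (y j)] may be exchanged. This frees [trf] and the Schatten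
    trace from the choice made by [epsilon]. *)
Lemma spec_unique m X e v x y f : msym m X -> spec m X e x -> spec m X v y ->
  rsum m (fun i => f (x i)) = rsum m (fun j => f (y j)).
Proof.
intros HX H1 H2.
transitivity (rsum m (fun i => rsum m (fun j => f (x i) * (dot m (e i) (v j) * dot m (e i) (v j))))).
{ apply rsum_ext; intros i Hi; rewrite rsum_scal.
  rewrite (overlap_row_sum m X X e v x y) by auto; ring. }
transitivity (rsum m (fun i => rsum m (fun j => f (y j) * (dot m (e i) (v j) * dot m (e i) (v j))))).
2:{ rewrite rsum_swap; apply rsum_ext; intros j Hj; rewrite rsum_scal.
  rewrite (overlap_col_sum m X X e v x y) by auto; ring. }
apply rsum_ext; intros i Hi; apply rsum_ext; intros j Hj.
assert (E1 := spec_mv_dot m X e x HX H1 (v j) i Hi).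
assert (E2 := spec_mv_dot m X v y HX H2 (e i) j Hj).
rewrite mv_selfadjoint, dot_comm, E2, dot_comm in E1 by auto.
destruct (Req_dec (dot m (e i) (v j)) 0) as [->|N]; [ring|].
rewrite (dot_comm m (v j)) in E1.
assert (y j = x i) as -> by (apply Rmult_eq_reg_r with (dot m (e i) (v j)); auto).
ring.
Qed.

Lemma spec_msq m X e x : spec m X e x -> spec m (msq m X) e (fun i => x i * x i).
Proof.
intros (H1 & H2 & H3); split; [|split]; auto.
intros i k Hi Hk; unfold msq; rewrite mv_mmul.
transitivity (x i * mv m X (e i) k); [|rewrite H3 by auto; ring].
unfold mv at 1 3; rewrite <- rsum_scal; apply rsum_ext; intros l Hl.
rewrite H3 by auto; ring.
Qed.

Definition eigsys (m : nat) (X : Mat) : (nat -> nat -> R) * (nat -> R) :=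
  epsilon (inhabits (fun _ _ => 0, fun _ => 0)) (fun ex => spec m X (fst ex) (snd ex)).
Definition evec m X := fst (eigsys m X).
Definition evl m X := snd (eigsys m X).

Lemma eigsys_spec m X : msym m X -> spec m X (evec m X) (evl m X).
Proof.
intros HX; apply (epsilon_spec _ (fun ex => spec m X (fst ex) (snd ex))).
destruct (RealSpectral.spectral_theorem m X HX) as (e & x & H); now exists (e, x).
Qed.

(* [trf f X] is [tr (f(X))] and [tf f X G] is [tr (G f(X))]. *)
Definition trf (m : nat) (f : R -> R) (X : Mat) : R := rsum m (fun i => f (evl m X i)).
Definition tf (m : nat) (f : R -> R) (X G : Mat) : R :=
  rsum m (fun i => f (evl m X i) * bil m G (evec m X i) (evec m X i)).
Definition ovl (m : nat) (X Y : Mat) (i j : nat) : R :=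
  dot m (evec m X i) (evec m Y j) * dot m (evec m X i) (evec m Y j).

Lemma ovl_ge0 m X Y i j : 0 <= ovl m X Y i j.
Proof. apply Rle_0_sqr. Qed.

Lemma trf_spec m X e x f : msym m X -> spec m X e x -> trf m f X = rsum m (fun i => f (x i)).
Proof. intros HX H; apply (spec_unique m X (evec m X) e); auto using eigsys_spec. Qed.

Lemma trf_msq m X f : msym m X -> trf m f (msq m X) = trf m (fun x => f (x * x)) X.
Proof.
intros HX; now apply (trf_spec _ _ (evec m X) (fun i => evl m X i * evl m X i));
  [apply msym_msq|apply spec_msq, eigsys_spec].
Qed.

Lemma trf_ext m X f g : (forall i, (i < m)%nat -> f (evl m X i) = g (evl m X i)) ->
  trf m f X = trf m g X.
Proof. apply rsum_ext. Qed.

Lemma evl_ge0 m X i : msym m X -> psd m X -> (i < m)%nat -> 0 <= evl m X i.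
Proof.
intros HX P Hi.
rewrite <- (spec_bil_diag m X (evec m X) (evl m X)); auto using eigsys_spec.
Qed.

Lemma tf_self m X f : msym m X -> tf m f X X = trf m (fun x => x * f x) X.
Proof.
intros HX; apply rsum_ext; intros i Hi.
rewrite (spec_bil_diag m X (evec m X) (evl m X)); auto using eigsys_spec; ring.
Qed.

Lemma tf_ge0 m X G f : (forall i, (i < m)%nat -> 0 <= f (evl m X i)) -> psd m G -> 0 <= tf m f X G.
Proof. intros Hf HG; apply rsum_nonneg; intros i Hi; apply Rmult_le_pos; auto. Qed.

Lemma tf_scal m X G c f : tf m (fun x => c * f x) X G = c * tf m f X G.
Proof. unfold tf; rewrite <- rsum_scal; apply rsum_ext; intros; ring. Qed.

(** * Traces as double sums over two spectra *)

Section DoubleSums.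
Variables (m : nat) (X Y : Mat).
Hypotheses (symX : msym m X) (symY : msym m Y).
Let specX := eigsys_spec m X symX.
Let specY := eigsys_spec m Y symY.
Notation x := (evl m X).
Notation y := (evl m Y).
Notation w := (ovl m X Y).

Lemma trf_double_l f : trf m f X = rsum m (fun i => rsum m (fun j => w i j * f (x i))).
Proof.
apply rsum_ext; intros i Hi; rewrite rsum_scal_r; unfold ovl.
rewrite (overlap_row_sum m X Y _ _ x y); auto; ring.
Qed.

Lemma trf_double_r f : trf m f Y = rsum m (fun i => rsum m (fun j => w i j * f (y j))).
Proof.
rewrite rsum_swap; apply rsum_ext; intros j Hj; rewrite rsum_scal_r; unfold ovl.
rewrite (overlap_col_sum m X Y _ _ x y); auto; ring.
Qed.

Lemma tf_double f : tf m f X Y = rsum m (fun i => rsum m (fun j => w i j * (f (x i) * y j))).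
Proof.
apply rsum_ext; intros i Hi; rewrite (spec_bil m Y _ y symY specY); rewrite <- rsum_scal.
apply rsum_ext; intros; unfold ovl; ring.
Qed.

Lemma tf_msq_double f :
  tf m f X (msq m Y) = rsum m (fun i => rsum m (fun j => w i j * (f (x i) * (y j * y j)))).
Proof.
apply rsum_ext; intros i Hi.
rewrite (spec_bil m (msq m Y) _ _ (msym_msq m Y symY) (spec_msq m Y _ _ specY)).
rewrite <- rsum_scal; apply rsum_ext; intros; unfold ovl; ring.
Qed.

Variable D : Mat.
Hypothesis diffD : forall i j, (i < m)%nat -> (j < m)%nat -> D i j = X i j - Y i j.

Lemma msym_diff : msym m D.
Proof.
intros i j Hi Hj; unfold mtr; rewrite !diffD by auto.
now rewrite (symX i j), (symY i j) by auto.
Qed.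

Lemma mv_diff u k : (k < m)%nat -> mv m D u k = mv m X u k - mv m Y u k.
Proof.
intros Hk; unfold mv; rewrite <- rsum_minus; apply rsum_ext; intros j Hj.
rewrite diffD by auto; ring.
Qed.

Lemma dot_mv_diff u v : dot m (mv m D u) v = dot m (mv m X u) v - dot m (mv m Y u) v.
Proof.
rewrite <- dot_minus_l; apply dot_ext; auto; apply mv_diff.
Qed.

(** Each of [X] and [Y] is applied to its own eigenvector. Thereby a factor [D] or [D^2] in a trace
    becomes [x i - y j] or its square under the double sum, however far [X] and [Y] are from
    commuting. *)
Lemma dot_mv_diff_l i j : (i < m)%nat -> (j < m)%nat ->
  dot m (mv m D (evec m X i)) (evec m Y j) = (x i - y j) * dot m (evec m X i) (evec m Y j).
Proof.
intros Hi Hj; rewrite dot_mv_diff, (spec_mv_dot m Y _ y symY specY) by auto.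
rewrite mv_selfadjoint, dot_comm, (spec_mv_dot m X _ x symX specX) by auto.
rewrite (dot_comm m (evec m Y j)); ring.
Qed.

Lemma dot_mv_diff_r i j : (i < m)%nat -> (j < m)%nat ->
  dot m (mv m D (evec m Y j)) (evec m X i) = (x i - y j) * dot m (evec m X i) (evec m Y j).
Proof.
intros Hi Hj; rewrite <- dot_mv_diff_l by auto.
rewrite mv_selfadjoint by apply msym_diff; apply dot_comm.
Qed.

Lemma tf_diff_double_l f :
  tf m f X D = rsum m (fun i => rsum m (fun j => w i j * (f (x i) * (x i - y j)))).
Proof.
apply rsum_ext; intros i Hi; unfold bil.
rewrite (spec_parseval m Y _ y specY), <- rsum_scal.
apply rsum_ext; intros j Hj; rewrite dot_mv_diff_l by auto; unfold ovl; ring.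
Qed.

Lemma tf_diff_double_r f :
  tf m f Y D = rsum m (fun i => rsum m (fun j => w i j * (f (y j) * (x i - y j)))).
Proof.
rewrite rsum_swap; apply rsum_ext; intros j Hj; unfold bil.
rewrite (spec_parseval m X _ x specX), <- rsum_scal.
apply rsum_ext; intros i Hi; rewrite dot_mv_diff_r, (dot_comm m (evec m Y j)) by auto.
unfold ovl; ring.
Qed.

Lemma tf_diffsq_double_l f :
  tf m f X (msq m D) =
  rsum m (fun i => rsum m (fun j => w i j * ((x i - y j) * (x i - y j) * f (x i)))).
Proof.
apply rsum_ext; intros i Hi; rewrite bil_msq by apply msym_diff.
rewrite (spec_parseval m Y _ y specY), <- rsum_scal.
apply rsum_ext; intros j Hj; rewrite dot_mv_diff_l by auto; unfold ovl; ring.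
Qed.

Lemma tf_diffsq_double_r f :
  tf m f Y (msq m D) =
  rsum m (fun i => rsum m (fun j => w i j * ((x i - y j) * (x i - y j) * f (y j)))).
Proof.
rewrite rsum_swap; apply rsum_ext; intros j Hj; rewrite bil_msq by apply msym_diff.
rewrite (spec_parseval m X _ x specX), <- rsum_scal.
apply rsum_ext; intros i Hi; rewrite dot_mv_diff_r by auto; unfold ovl; ring.
Qed.

Lemma klein_trace g h :
  (forall i j, (i < m)%nat -> (j < m)%nat ->
     (x i - y j) * (g (x i) - g (y j)) <= (x i - y j) * (x i - y j) * (h (x i) + h (y j))) ->
  tf m g X D - tf m g Y D <= tf m h X (msq m D) + tf m h Y (msq m D).
Proof.
intros H.
rewrite tf_diff_double_l, tf_diff_double_r, tf_diffsq_double_l, tf_diffsq_double_r.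
rewrite <- rsum_minus, <- rsum_plus; apply rsum_le; intros i Hi.
rewrite <- rsum_minus, <- rsum_plus; apply rsum_le; intros j Hj.
assert (Hw := Rmult_le_compat_l _ _ _ (ovl_ge0 m X Y i j) (H i j Hi Hj)).
lra.
Qed.

End DoubleSums.

Lemma tf_young m X Y f phi psi : msym m X -> msym m Y ->
  (forall i j, (i < m)%nat -> (j < m)%nat ->
     f (evl m X i) * evl m Y j <= phi (evl m Y j) + psi (evl m X i)) ->
  tf m f X Y <= trf m phi Y + trf m psi X.
Proof.
intros HX HY H.
rewrite tf_double, (trf_double_r m X Y), (trf_double_l m X Y) by auto.
rewrite <- rsum_plus; apply rsum_le; intros i Hi.
rewrite <- rsum_plus; apply rsum_le; intros j Hj.
assert (Hw := Rmult_le_compat_l _ _ _ (ovl_ge0 m X Y i j) (H i j Hi Hj)).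
lra.
Qed.

(** * Adding a positive matrix *)

Lemma bil_scal m c X u v : bil m (fun i j => c * X i j) u v = c * bil m X u v.
Proof.
unfold bil; rewrite dot_comm, (dot_comm m u), <- dot_scal_l; apply dot_ext; auto.
intros k _; unfold mv; rewrite <- rsum_scal; apply rsum_ext; intros; ring.
Qed.

Lemma bil_plus m X Y u v : bil m (fun i j => X i j + Y i j) u v = bil m X u v + bil m Y u v.
Proof.
unfold bil, dot; rewrite <- rsum_plus; apply rsum_ext; intros k _.
rewrite <- Rmult_plus_distr_l; f_equal; unfold mv; rewrite <- rsum_plus.
apply rsum_ext; intros; ring.
Qed.

Lemma tf_scal_r m f X G c : tf m f X (fun i j => c * G i j) = c * tf m f X G.
Proof.
unfold tf; rewrite <- rsum_scal; apply rsum_ext; intros; rewrite bil_scal; ring.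
Qed.

Lemma msq_scal m c X : msq m (fun i j => c * X i j) = (fun i j => c * c * msq m X i j).
Proof.
extensionality i; extensionality j; unfold msq, mmul; rewrite <- rsum_scal.
apply rsum_ext; intros; ring.
Qed.

Definition madd (X Y : Mat) : Mat := fun i j => X i j + Y i j.

Lemma msym_madd m X Y : msym m X -> msym m Y -> msym m (madd X Y).
Proof.
intros HX HY i j Hi Hj; unfold madd, mtr; now rewrite (HX i j), (HY i j) by auto.
Qed.

Lemma msym_scal m c X : msym m X -> msym m (fun i j => c * X i j).
Proof. intros HX i j Hi Hj; unfold mtr; now rewrite (HX i j) by auto. Qed.

Lemma psd_madd m X Y : psd m X -> psd m Y -> psd m (madd X Y).
Proof.
intros HX HY u; unfold madd; rewrite bil_plus; specialize (HX u); specialize (HY u); lra.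
Qed.

Lemma psd_scal m c X : 0 <= c -> psd m X -> psd m (fun i j => c * X i j).
Proof. intros Hc HX u; rewrite bil_scal; now apply Rmult_le_pos. Qed.

(* The compression [b <u, Z^-1 u> <= 1] of [Z^-1 <= B^-1] to an eigenvector [u] of [B <= Z];
   [Z^-1] is the pseudo-inverse. *)
Lemma inverse_overlap m Z B j : msym m Z -> msym m B -> psd m Z -> psd m B ->
  (forall u, bil m B u u <= bil m Z u u) -> (j < m)%nat ->
  evl m B j * rsum m (fun i => ovl m Z B i j * (if Rlt_dec 0 (evl m Z i) then / evl m Z i else 0)) <= 1.
Proof.
intros symZ symB psdZ psdB BleZ Hj.
set (z := evl m Z); set (e := evec m Z); set (u := evec m B j).
set (iz := fun i => if Rlt_dec 0 (z i) then / z i else 0).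
assert (Hz : spec m Z e z) by now apply eigsys_spec.
assert (Hb : spec m B (evec m B) (evl m B)) by now apply eigsys_spec.
(* [v] is [Z^-1 u], so [<v, u> = <v, Z v> = sg], whereas the [j]-th term of the spectral expansion
   alone gives [<v, B v> >= b <v, u>^2]. Hence [b sg^2 <= sg]. *)
set (c := fun i => iz i * dot m (e i) u).
set (v := fun k => rsum m (fun i => c i * e i k)).
set (sg := rsum m (fun i => ovl m Z B i j * iz i)).
assert (Hv : forall l, (l < m)%nat -> dot m v (e l) = c l).
{ intros l Hl; unfold v; rewrite (dot_rsum_l m m (fun i k => c i * e i k)).
  rewrite (rsum_ext m _ (fun i => if Nat.eqb i l then c i else 0)); [now apply rsum_delta|].
  intros i Hi; rewrite dot_scal_l; destruct Hz as (orth & _); rewrite orth by auto.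
  destruct (Nat.eqb i l); ring. }
assert (iz0 : forall i, 0 <= iz i).
{ intros i; unfold iz; destruct (Rlt_dec 0 (z i)); [left; now apply Rinv_0_lt_compat|lra]. }
assert (Euv : dot m v u = sg).
{ rewrite (spec_parseval m Z e z Hz); apply rsum_ext; intros i Hi; rewrite Hv by auto.
  unfold c, ovl, u; rewrite (dot_comm m (evec m B j)); fold e; ring. }
assert (EZ : bil m Z v v = sg).
{ rewrite (spec_bil m Z e z symZ Hz); apply rsum_ext; intros i Hi; rewrite Hv by auto.
  assert (z i * iz i * iz i = iz i).
  { unfold iz; destruct (Rlt_dec 0 (z i)); [field; lra|ring]. }
  unfold c, ovl; fold e u.
  replace (z i * (iz i * dot m (e i) u * (iz i * dot m (e i) u)))
    with ((z i * iz i * iz i) * (dot m (e i) u * dot m (e i) u)) by ring.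
  rewrite H; ring. }
assert (EB : evl m B j * (sg * sg) <= bil m B v v).
{ rewrite (spec_bil m B _ _ symB Hb).
  rewrite <- Euv; unfold u.
  rewrite <- (rsum_delta m (fun i => evl m B i * (dot m v (evec m B i) * dot m v (evec m B i))) j Hj).
  apply rsum_le; intros i Hi.
  assert (0 <= evl m B i * (dot m v (evec m B i) * dot m v (evec m B i))).
  { apply Rmult_le_pos; [now apply evl_ge0|apply Rle_0_sqr]. }
  destruct (Nat.eqb_spec i j) as [->|]; lra. }
specialize (BleZ v); rewrite EZ in BleZ.
fold iz; change (evl m B j * sg <= 1).
assert (0 <= sg).
{ apply rsum_nonneg; intros; apply Rmult_le_pos; auto using ovl_ge0. }
destruct H as [H| <-]; [|lra].
apply Rmult_le_reg_r with sg; auto; lra.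
Qed.

(** For an eigenvector of [B] with eigenvalue [b], [rpow_concave_young] is averaged over the
    spectral weights of [Z]. The mean of [b / z] is at most 1 by [inverse_overlap], so the bracket
    is at most [(1 - s) + s = 1]. *)
Lemma tf_rpow_msq_le m Z B s : 0 <= s <= 1 -> msym m Z -> msym m B -> psd m Z -> psd m B ->
  (forall u, bil m B u u <= bil m Z u u) ->
  tf m (fun x => rpow x (s - 1)) Z (msq m B) <= trf m (fun x => rpow x (s + 1)) B.
Proof.
intros Hs symZ symB psdZ psdB BleZ.
rewrite tf_msq_double by auto; rewrite rsum_swap; apply rsum_le; intros j Hj.
set (b := evl m B j).
assert (Hb : 0 <= b) by now apply evl_ge0.
destruct Hb as [Hb|Hb].
2:{ rewrite <- Hb; rewrite (rsum_ext m _ (fun _ => 0)); [rewrite rsum_zero; apply rpow_ge0|].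
    intros; ring. }
set (iz := fun i => if Rlt_dec 0 (evl m Z i) then / evl m Z i else 0).
apply Rle_trans with (rsum m (fun i => rpow b (s + 1) * ((1 - s) * b * (ovl m Z B i j * iz i) + s * ovl m Z B i j))).
- apply rsum_le; intros i Hi.
  assert (W := ovl_ge0 m Z B i j).
  assert (P := rpow_gt0 b (s + 1) Hb).
  unfold iz; destruct (Rlt_dec 0 (evl m Z i)) as [Hz|Hz].
  + assert (Y := rpow_concave_young s b (evl m Z i) Hs Hb Hz).
    apply (Rmult_le_compat_l _ _ _ W) in Y; unfold Rdiv in Y; lra.
  + rewrite rpow_npos by lra. rewrite !Rmult_0_l, !Rmult_0_r, Rplus_0_l.
    apply Rmult_le_pos; [lra|]; apply Rmult_le_pos; lra.
- rewrite rsum_scal, rsum_plus, !rsum_scal.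
  assert (E : rsum m (fun i => ovl m Z B i j) = 1).
  { apply (overlap_col_sum m Z B _ _ (evl m Z) (evl m B)); auto using eigsys_spec. }
  rewrite E.
  assert (I : b * rsum m (fun i => ovl m Z B i j * iz i) <= 1) by now apply inverse_overlap.
  set (S := rsum m (fun i => ovl m Z B i j * iz i)) in *.
  rewrite <- (Rmult_1_r (rpow b (s + 1))) at 2; apply Rmult_le_compat_l; [apply rpow_ge0|].
  rewrite Rmult_assoc.
  assert ((1 - s) * (b * S) <= (1 - s) * 1) by (apply Rmult_le_compat_l; lra).
  lra.
Qed.

(** The concave Klein inequality, with the derivative at [Z = Y + B] only, bounds the increment by
    [tr (B^2 Z^(s-1))], and [B <= Z] bounds this by [tr B^(s+1)]. The symmetric form [klein_trace]
    would bring in [Y^(s-1)], which is out of control since [B <= Y] may fail. *)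
Lemma tf_add_concave m Y B s : 0 <= s <= 1 -> msym m Y -> msym m B -> psd m Y -> psd m B ->
  tf m (fun x => rpow x s) (madd Y B) B <=
  trf m (fun x => rpow x (s + 1)) B + tf m (fun x => rpow x s) Y B.
Proof.
intros Hs symY symB psdY psdB.
set (Z := madd Y B).
assert (symZ : msym m Z) by now apply msym_madd.
assert (psdZ : psd m Z) by now apply psd_madd.
assert (diff : forall i j, (i < m)%nat -> (j < m)%nat -> B i j = Z i j - Y i j) by (intros; unfold Z, madd; ring).
assert (EZ : forall u, bil m Z u u = bil m Y u u + bil m B u u) by (intros; apply bil_plus).
apply Rle_trans with (tf m (fun x => rpow x (s - 1)) Z (msq m B) + tf m (fun x => rpow x s) Y B).
2:{ apply Rplus_le_compat_r, tf_rpow_msq_le; auto.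
    intros u; rewrite EZ; specialize (psdY u); lra. }
rewrite (tf_diff_double_l m Z Y), (tf_diff_double_r m Z Y), (tf_diffsq_double_l m Z Y) by auto.
rewrite <- rsum_plus; apply rsum_le; intros i Hi.
rewrite <- rsum_plus; apply rsum_le; intros j Hj.
assert (Hz := evl_ge0 m Z i symZ psdZ Hi); assert (Hy := evl_ge0 m Y j symY psdY Hj).
assert (W := ovl_ge0 m Z Y i j).
destruct Hz as [Hz|Hz].
- assert (K := rpow_klein_concave s _ _ (proj2 Hs) Hz Hy).
  apply (Rmult_le_compat_l _ _ _ W) in K; lra.
- (* a kernel vector of Z is a kernel vector of Y *)
  assert (bZ : bil m Z (evec m Z i) (evec m Z i) = 0).
  { rewrite (spec_bil_diag m Z _ (evl m Z)); auto using eigsys_spec. }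
  rewrite EZ in bZ.
  assert (P1 := psdY (evec m Z i)); assert (P2 := psdB (evec m Z i)).
  assert (bY : bil m Y (evec m Z i) (evec m Z i) = 0) by lra.
  rewrite (spec_bil m Y _ _ symY (eigsys_spec m Y symY)) in bY.
  assert (N : ovl m Z Y i j * evl m Y j = 0).
  { rewrite Rmult_comm.
    refine (rsum_nonneg_eq0 m _ j _ bY Hj).
    intros l Hl; apply Rmult_le_pos; [now apply evl_ge0|apply Rle_0_sqr]. }
  rewrite <- Hz, !(rpow_npos 0) by lra.
  apply Rmult_integral in N; destruct N as [-> | ->]; [lra|].
  rewrite (rpow_npos 0); lra.
Qed.

(** Pointwise this is Young's inequality for [(L b) z^(s-1)], multiplied by [b / L], with the
    weights [1/s] and [(s-1)/s] enlarged to 1. A large [L] makes the coefficient of the term to be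
    iterated small. *)
Lemma tf_rpow_msq_young m Z B s L : 1 <= s -> 0 < L -> msym m Z -> msym m B -> psd m Z -> psd m B ->
  tf m (fun x => rpow x (s - 1)) Z (msq m B) <=
  rpow L (s - 1) * trf m (fun x => rpow x (s + 1)) B + / L * tf m (fun x => rpow x s) Z B.
Proof.
intros Hs HL symZ symB psdZ psdB.
rewrite tf_msq_double, (trf_double_r m Z B), tf_double by auto.
rewrite <- !rsum_scal, <- rsum_plus; apply rsum_le; intros i Hi.
rewrite <- !rsum_scal, <- rsum_plus; apply rsum_le; intros j Hj.
assert (Hz := evl_ge0 m Z i symZ psdZ Hi); assert (Hb := evl_ge0 m B j symB psdB Hj).
assert (W := ovl_ge0 m Z B i j).
set (z := evl m Z i) in *; set (b := evl m B j) in *; set (w := ovl m Z B i j) in *.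
assert (K : rpow z (s - 1) * (b * b) <= rpow L (s - 1) * rpow b (s + 1) + / L * (rpow z s * b)).
2:{ apply (Rmult_le_compat_l _ _ _ W) in K; lra. }
assert (Y := young (L * b) z s Hs (Rmult_le_pos _ _ (Rlt_le _ _ HL) Hb) Hz).
rewrite (rpow_mul L b), <- (rpow_pred L s) in Y by lra.
rewrite <- (rpow_succ b s) by auto.
assert (P1 := rpow_ge0 z s); assert (P2 := rpow_ge0 b s); assert (P3 := rpow_ge0 L (s - 1)).
assert (F1 : L * rpow L (s - 1) * rpow b s / s <= L * rpow L (s - 1) * rpow b s).
{ rewrite <- (Rmult_1_r (L * rpow L (s - 1) * rpow b s)) at 2; apply Rmult_le_compat_l.
  - repeat apply Rmult_le_pos; lra.
  - rewrite <- Rinv_1; apply Rinv_le_contravar; lra. }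
assert (F2 : (s - 1) / s * rpow z s <= rpow z s).
{ rewrite <- (Rmult_1_l (rpow z s)) at 2; apply Rmult_le_compat_r; auto.
  apply Rmult_le_reg_r with s; [lra|]; field_simplify; lra. }
assert (Y' : L * b * rpow z (s - 1) <= L * rpow L (s - 1) * rpow b s + rpow z s) by lra.
assert (C : 0 <= b * / L) by (apply Rmult_le_pos; auto; left; now apply Rinv_0_lt_compat).
apply (Rmult_le_compat_l _ _ _ C) in Y'.
replace (b * / L * (L * b * rpow z (s - 1))) with (rpow z (s - 1) * (b * b)) in Y' by (field; lra).
replace (b * / L * (L * rpow L (s - 1) * rpow b s + rpow z s))
  with (rpow L (s - 1) * (b * rpow b s) + / L * (rpow z s * b)) in Y' by (field; lra).
exact Y'.
Qed.

(* One step of a discretised differential inequality for [t |-> tr (B (Y + tB)^s)]. *)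
Lemma tf_add_step m Z B s L h : 1 <= s -> 0 < L -> 0 < h ->
  msym m Z -> msym m B -> psd m Z -> psd m B ->
  let f := fun X => tf m (fun x => rpow x s) X B in
  let Z' := madd Z (fun i j => h * B i j) in
  f Z' - f Z <= s * h * (2 * (rpow L (s - 1) * trf m (fun x => rpow x (s + 1)) B) + / L * (f Z + f Z')).
Proof.
intros Hs HL Hh symZ symB psdZ psdB f Z'.
assert (symZ' : msym m Z') by (apply msym_madd; auto using msym_scal).
assert (psdZ' : psd m Z') by (apply psd_madd; auto; apply psd_scal; auto; lra).
assert (K := klein_trace m Z' Z symZ' symZ (fun i j => h * B i j)
  ltac:(intros; unfold Z', madd; ring) (fun x => rpow x s) (fun x => s * rpow x (s - 1))).
rewrite !tf_scal_r, msq_scal, !tf_scal_r, !tf_scal in K.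
assert (H := K (fun i j Hi Hj => rpow_klein s _ _ Hs (evl_ge0 m Z' i symZ' psdZ' Hi) (evl_ge0 m Z j symZ psdZ Hj))).
clear K.
assert (Y1 := tf_rpow_msq_young m Z B s L Hs HL symZ symB psdZ psdB).
assert (Y2 := tf_rpow_msq_young m Z' B s L Hs HL symZ' symB psdZ' psdB).
fold (f Z) in *; fold (f Z') in *.
set (p1 := tf m (fun x => rpow x (s - 1)) Z (msq m B)) in *.
set (p2 := tf m (fun x => rpow x (s - 1)) Z' (msq m B)) in *.
(* Klein's inequality for [D = h B] carries [h] on the left and [h^2] on the right; one factor [h]
   cancels. *)
apply Rmult_le_reg_l with h; auto.
apply Rle_trans with (h * h * (s * p2) + h * h * (s * p1)); [lra|].
set (a := rpow L (s - 1) * trf m (fun x => rpow x (s + 1)) B) in *.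
replace (h * h * (s * p2) + h * h * (s * p1)) with (h * (s * h) * (p1 + p2)) by ring.
rewrite <- (Rmult_assoc h (s * h)); apply Rmult_le_compat_l; [|lra].
apply Rmult_le_pos; [lra|]; apply Rmult_le_pos; lra.
Qed.

(** Gronwall's inequality for an implicit scheme: solving for [f (S i)] costs
    [1 / (1 - k) <= 1 + 2 k <= exp (2 k)], where [k <= 1/2] enters, and the explicit part costs
    [1 + k <= exp k]; hence [exp (3 k)] per step. *)
Lemma recurrence_exp_bound (f : nat -> R) (k C : R) (N : nat) : 0 <= k <= / 2 -> 0 <= C ->
  (forall i, 0 <= f i) -> (forall i, f (S i) - f i <= C + k * (f i + f (S i))) ->
  f N <= exp (3 * k * INR N) * (f O + INR N * C).
Proof.
intros Hk HC f0 step.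
induction N as [|N IH]; [simpl; rewrite Rmult_0_r, exp_0; lra|].
assert (E : f (S N) <= exp (3 * k) * (f N + C)).
{ assert (e1 := exp_ineq1_le k); assert (e2 := exp_ineq1_le (2 * k)).
  replace (3 * k) with (k + 2 * k) by ring; rewrite exp_plus.
  assert (S1 : (1 - k) * f (S N) <= (1 + k) * f N + C) by (specialize (step N); lra).
  assert (H0 := f0 N); assert (H1 := f0 (S N)).
  assert (S2 : f (S N) <= (1 + 2 * k) * ((1 - k) * f (S N))).
  { replace ((1 + 2 * k) * ((1 - k) * f (S N))) with (f (S N) + (k * (1 - 2 * k)) * f (S N)) by ring.
    assert (0 <= (k * (1 - 2 * k)) * f (S N)) by (apply Rmult_le_pos; auto; apply Rmult_le_pos; lra); lra. }
  assert (S3 : (1 - k) * f (S N) <= (1 + k) * (f N + C)) by nra.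
  assert (S4 : (1 + k) * (f N + C) <= exp k * (f N + C)) by (apply Rmult_le_compat_r; lra).
  assert (P := exp_pos k).
  assert (0 <= exp k * (f N + C)) by (apply Rmult_le_pos; lra).
  apply Rle_trans with ((1 + 2 * k) * (exp k * (f N + C))).
  - apply Rle_trans with (1 := S2); apply Rmult_le_compat_l; lra.
  - replace (exp k * exp (2 * k) * (f N + C)) with (exp (2 * k) * (exp k * (f N + C))) by ring.
    apply Rmult_le_compat_r; lra. }
apply Rle_trans with (1 := E).
rewrite S_INR; replace (3 * k * (INR N + 1)) with (3 * k + 3 * k * INR N) by ring.
rewrite exp_plus, Rmult_assoc; apply Rmult_le_compat_l; [left; apply exp_pos|].
assert (1 <= exp (3 * k * INR N)).
{ assert (H := exp_ineq1_le (3 * k * INR N)).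
  assert (0 <= 3 * k * INR N) by (apply Rmult_le_pos; [lra|apply pos_INR]); lra. }
assert (C <= exp (3 * k * INR N) * C) by nra.
lra.
Qed.

Lemma tf_add_convex m Y B s L : 1 <= s -> 0 < L -> msym m Y -> msym m B -> psd m Y -> psd m B ->
  tf m (fun x => rpow x s) (madd Y B) B <=
  exp (3 * (s / L)) *
  (tf m (fun x => rpow x s) Y B + 2 * (s / L) * rpow L s * trf m (fun x => rpow x (s + 1)) B).
Proof.
intros Hs HL symY symB psdY psdB.
(* [B] is added in [N] portions [B / N]. The rate per step is [s / (L N)], below [1/2] for this [N];
   the total [exp (3 s / L)] does not depend on [N], so no limit is taken. *)
destruct (INR_unbounded (2 * (s / L))) as [N HN].
assert (sL : 0 < s / L) by (apply Rdiv_lt_0_compat; lra).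
assert (N0 : 0 < INR N) by lra.
set (Zt := fun i => madd Y (fun a b => INR i * / INR N * B a b)).
set (al := trf m (fun x => rpow x (s + 1)) B).
assert (psdZ : forall i, psd m (Zt i)).
{ intros i; apply psd_madd; auto; apply psd_scal; auto.
  apply Rmult_le_pos; [apply pos_INR|left; now apply Rinv_0_lt_compat]. }
assert (symZ : forall i, msym m (Zt i)) by (intros i; apply msym_madd; auto using msym_scal).
assert (al0 : 0 <= al) by (apply rsum_nonneg; intros; apply rpow_ge0).
assert (H := recurrence_exp_bound (fun i => tf m (fun x => rpow x s) (Zt i) B)
   (s / L / INR N) (2 * (s / L / INR N) * rpow L s * al) N).
replace (madd Y B) with (Zt N).
2:{ extensionality i; extensionality j; unfold Zt, madd; field; lra. }
replace (3 * (s / L)) with (3 * (s / L / INR N) * INR N) by (field; lra).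
replace (2 * (s / L) * rpow L s * al) with (INR N * (2 * (s / L / INR N) * rpow L s * al)) by (field; lra).
replace (tf m (fun x => rpow x s) Y B) with (tf m (fun x => rpow x s) (Zt O) B).
2:{ f_equal; extensionality i; extensionality j; unfold Zt, madd; simpl; ring. }
assert (k0 : 0 < s / L / INR N) by (apply Rdiv_lt_0_compat; lra).
apply H; clear H.
- split; [lra|]; apply Rmult_le_reg_r with (2 * INR N); [lra|]; field_simplify; lra.
- apply Rmult_le_pos; auto; apply Rmult_le_pos; [lra|apply rpow_ge0].
- intros i; apply tf_ge0; auto; intros; apply rpow_ge0.
- intros i.
  assert (St := tf_add_step m (Zt i) B s L (/ INR N) Hs HL (Rinv_0_lt_compat _ N0) (symZ i) symB (psdZ i) psdB).
  cbv zeta in St.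
  replace (madd (Zt i) (fun a b => / INR N * B a b)) with (Zt (S i)) in St.
  2:{ extensionality a; extensionality b; unfold Zt, madd; rewrite S_INR; ring. }
  apply Rle_trans with (1 := St); apply Req_le; fold al.
  rewrite <- (rpow_pred L s) by lra.
  field; lra.
Qed.

(** * Rademacher sums *)

(** Boolean lists encode both signs and subsets, so this changes one sign or moves one index into or
    out of a set. *)
Fixpoint flip (j : nat) (s : list bool) : list bool :=
  match s with
  | [] => []
  | b :: t => match j with O => negb b :: t | S j' => b :: flip j' t end
  end.

Lemma lsum_bvecs_S n (F : list bool -> R) :
  lsum (bvecs (S n)) F = lsum (bvecs n) (fun s => F (true :: s)) + lsum (bvecs n) (fun s => F (false :: s)).
Proof. cbn [bvecs]; now rewrite lsum_app, !lsum_map. Qed.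

Lemma lsum_bvecs_flip n j (F : list bool -> R) :
  lsum (bvecs n) (fun s => F (flip j s)) = lsum (bvecs n) F.
Proof.
revert j F; induction n as [|n IH]; intros j F; [destruct j; reflexivity|].
rewrite !lsum_bvecs_S; destruct j as [|j]; cbn [flip negb]; [ring|].
rewrite (IH j (fun s => F (true :: s))), (IH j (fun s => F (false :: s))); reflexivity.
Qed.

Lemma bvecs_length n s : In s (bvecs n) -> length s = n.
Proof.
revert s; induction n as [|n IH]; intros s; cbn [bvecs].
- intros [<-|[]]; reflexivity.
- rewrite in_app_iff, !in_map_iff; intros [(t & <- & H)|(t & <- & H)]; cbn [length]; now rewrite IH.
Qed.

Lemma length_bvecs n : INR (length (bvecs n)) = 2 ^ n.
Proof.
induction n as [|n IH]; [reflexivity|].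
cbn [bvecs]; rewrite length_app, !length_map, plus_INR, IH; simpl; ring.
Qed.

Lemma nth_flip s i j : (j < length s)%nat ->
  nth i (flip j s) false = if Nat.eqb i j then negb (nth j s false) else nth i s false.
Proof.
revert i j; induction s as [|b s IH]; intros i j Hj; cbn [length] in Hj; [lia|].
destruct j as [|j], i as [|i]; cbn [flip nth Nat.eqb]; auto; apply IH; lia.
Qed.

Lemma flip_flip s j : flip j (flip j s) = s.
Proof.
revert j; induction s as [|b s IH]; intros j; [destruct j; reflexivity|].
destruct j as [|j]; cbn [flip]; [now rewrite Bool.negb_involutive|now rewrite IH].
Qed.

Lemma card_cons b s : card (b :: s) = ((if b then 1 else 0) + card s)%nat.
Proof. destruct b; reflexivity. Qed.

Lemma card_flip_true s j : nth j s false = true -> card s = S (card (flip j s)).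
Proof.
revert j; induction s as [|b s IH]; intros j; [destruct j; discriminate|].
destruct j as [|j]; cbn [nth flip]; rewrite !card_cons; [intros ->; reflexivity|].
intros H; rewrite (IH _ H); lia.
Qed.

Definition lin (n : nat) (c : nat -> R) (A : nat -> Mat) : Mat :=
  fun i k => rsum n (fun j => c j * A j i k).

Lemma msym_lin m n c A : (forall j, (j < n)%nat -> msym m (A j)) -> msym m (lin n c A).
Proof.
intros H i k Hi Hk; unfold mtr; apply rsum_ext; intros j Hj; now rewrite (H j Hj i k).
Qed.

Lemma mv_lin m n c A u k : mv m (lin n c A) u k = rsum n (fun j => c j * mv m (A j) u k).
Proof.
unfold mv, lin.
rewrite (rsum_ext m _ (fun i => rsum n (fun j => c j * A j k i * u i))) by (intros; now rewrite <- rsum_scal_r).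
rewrite rsum_swap; apply rsum_ext; intros j _; rewrite <- rsum_scal; apply rsum_ext; intros; ring.
Qed.

Lemma dot_mv_lin_l m n c A u v : dot m (mv m (lin n c A) u) v = rsum n (fun j => c j * dot m (mv m (A j) u) v).
Proof.
rewrite (dot_ext m _ (fun k => rsum n (fun j => c j * mv m (A j) u k)) v v) by (auto using mv_lin).
rewrite (dot_rsum_l m n (fun j k => c j * mv m (A j) u k)); apply rsum_ext; intros; apply dot_scal_l.
Qed.

Lemma bil_lin m n c A u v : bil m (lin n c A) u v = rsum n (fun j => c j * bil m (A j) u v).
Proof.
unfold bil; rewrite dot_comm, dot_mv_lin_l; apply rsum_ext; intros; now rewrite (dot_comm m u).
Qed.

Lemma psd_lin m n c A : (forall j, (j < n)%nat -> 0 <= c j /\ psd m (A j)) -> psd m (lin n c A).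
Proof.
intros H u; rewrite bil_lin; apply rsum_nonneg; intros j Hj.
destruct (H j Hj); now apply Rmult_le_pos.
Qed.

Lemma tf_lin m f X n c A : tf m f X (lin n c A) = rsum n (fun j => c j * tf m f X (A j)).
Proof.
unfold tf.
rewrite (rsum_ext m _ (fun i => rsum n (fun j => f (evl m X i) * (c j * bil m (A j) (evec m X i) (evec m X i)))))
  by (intros; now rewrite bil_lin, <- rsum_scal).
rewrite rsum_swap; apply rsum_ext; intros j _; rewrite <- rsum_scal; apply rsum_ext; intros; ring.
Qed.

Definition sg (eps : list bool) (j : nat) : R := sgn (nth j eps false).

Lemma sg_sqr eps j : sg eps j * sg eps j = 1.
Proof. unfold sg, sgn; destruct (nth j eps false); ring. Qed.

Lemma sg_flip eps i j : (j < length eps)%nat ->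
  sg (flip j eps) i = if Nat.eqb i j then - sg eps j else sg eps i.
Proof.
intros Hj; unfold sg; rewrite nth_flip by auto.
destruct (Nat.eqb i j); auto; destruct (nth j eps false); unfold sgn, negb; ring.
Qed.

(** * Khintchine's inequality and its converse *)

Section RademacherSums.
Variables (m n : nat) (A : nat -> Mat).
Hypothesis symA : forall j, (j < n)%nat -> msym m (A j).
Notation X eps := (lin n (sg eps) A).
Notation V := (lin n (fun _ => 1) (fun j => msq m (A j))).

Let symX eps : msym m (X eps).
Proof. now apply msym_lin. Qed.

Let symV : msym m V.
Proof. apply msym_lin; auto using msym_msq. Qed.

Let psdV : psd m V.
Proof. apply psd_lin; intros; split; [lra|apply psd_msq; auto]. Qed.

(* Flipping [eps_j] changes [X] by [D = 2 eps_j A_j]; Klein's inequality then bounds the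
   discrete derivative. *)
Lemma rademacher_flip_bound p j : 2 <= p -> (j < n)%nat ->
  lsum (bvecs n) (fun eps => sg eps j * tf m (fun x => spow x (p - 1)) (X eps) (A j)) <=
  2 * (p - 1) * lsum (bvecs n) (fun eps => tf m (fun x => rpow (Rabs x) (p - 2)) (X eps) (msq m (A j))).
Proof.
intros Hp Hj.
set (G := fun eps => sg eps j * tf m (fun x => spow x (p - 1)) (X eps) (A j)).
set (H := fun eps => tf m (fun x => rpow (Rabs x) (p - 2)) (X eps) (msq m (A j))).
change (lsum (bvecs n) G <= 2 * (p - 1) * lsum (bvecs n) H).
(* Flipping permutes the signs, so both sums may be symmetrised; [G eps + G (flip j eps)] is the
   difference of [tr (eps_j A_j g(X))] between the two values of [X], with the factor [eps_j] held
   fixed. *)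
assert (E : lsum (bvecs n) (fun eps => G eps + G (flip j eps)) <=
  lsum (bvecs n) (fun eps => 2 * (p - 1) * H eps + 2 * (p - 1) * H (flip j eps))).
2:{ rewrite !lsum_plus in E.
    rewrite (lsum_bvecs_flip n j G) in E.
    rewrite (lsum_bvecs_flip n j (fun eps => 2 * (p - 1) * H eps)), lsum_scal in E; lra. }
apply lsum_le; intros eps Heps.
assert (Hlen : (j < length eps)%nat) by (rewrite (bvecs_length n eps); auto).
set (D := fun i k => 2 * sg eps j * A j i k).
assert (diff : forall i k, (i < m)%nat -> (k < m)%nat -> D i k = X eps i k - X (flip j eps) i k).
{ intros i k _ _; unfold lin; rewrite <- rsum_minus.
  rewrite (rsum_ext n _ (fun l => if Nat.eqb l j then 2 * sg eps l * A l i k else 0)).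
  - now rewrite (rsum_delta n (fun l => 2 * sg eps l * A l i k)).
  - intros l Hl; rewrite sg_flip by auto; destruct (Nat.eqb_spec l j) as [->|]; ring. }
assert (K := klein_trace m (X eps) (X (flip j eps)) (symX eps) (symX (flip j eps)) D diff
  (fun x => spow x (p - 1)) (fun x => (p - 1) * rpow (Rabs x) (p - 1 - 1))).
assert (K' := K (fun i k _ _ => spow_klein (p - 1) _ _ ltac:(lra))); clear K.
replace (p - 1 - 1) with (p - 2) in K' by ring.
unfold D in K'; rewrite !tf_scal_r, !tf_scal, msq_scal, !tf_scal_r in K'.
replace (2 * sg eps j * (2 * sg eps j)) with 4 in K'
  by (rewrite <- (Rmult_1_r 4), <- (sg_sqr eps j) at 1; ring).
unfold G, H; rewrite sg_flip, Nat.eqb_refl by auto.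
lra.
Qed.

Lemma trf_abs_rpow_lin p eps :
  trf m (fun x => rpow (Rabs x) p) (X eps) =
  rsum n (fun j => sg eps j * tf m (fun x => spow x (p - 1)) (X eps) (A j)).
Proof.
rewrite <- tf_lin, tf_self by auto; apply trf_ext; intros i _.
rewrite mult_spow; f_equal; ring.
Qed.

Lemma tf_abs_young p c eps : 2 <= p -> 0 <= c ->
  c * tf m (fun x => rpow (Rabs x) (p - 2)) (X eps) V <=
  rpow c (p / 2) / (p / 2) * trf m (fun x => rpow x (p / 2)) V +
  (p / 2 - 1) / (p / 2) * trf m (fun x => rpow (Rabs x) p) (X eps).
Proof.
intros Hp Hc; rewrite <- tf_scal.
unfold trf; rewrite <- !rsum_scal.
apply (tf_young m (X eps) V (fun x => c * rpow (Rabs x) (p - 2))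
  (fun v => rpow c (p / 2) / (p / 2) * rpow v (p / 2))
  (fun x => (p / 2 - 1) / (p / 2) * rpow (Rabs x) p)); auto.
intros i j Hi Hj.
set (x := evl m (X eps) i).
assert (Hv := evl_ge0 m V j symV psdV Hj); set (v := evl m V j) in *.
assert (Y := young (c * v) (rpow (Rabs x) 2) (p / 2) ltac:(lra)
  (Rmult_le_pos _ _ Hc Hv) (rpow_ge0 _ _)).
rewrite !rpow_mult, rpow_mul in Y by auto.
replace (2 * (p / 2)) with p in Y by field.
replace (2 * (p / 2 - 1)) with (p - 2) in Y by field.
unfold Rdiv in *; lra.
Qed.

(** Summing the flip bounds over [j] gives [E tr |X|^p <= c E tr (|X|^(p-2) V)]. Young's inequality
    with first exponent [p/2] returns the fraction [1 - 2/p] of the left side, which is absorbed. *)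
Theorem khintchine_upper p : 2 <= p ->
  lsum (bvecs n) (fun eps => trf m (fun x => rpow (Rabs x) p) (X eps)) <=
  rpow (2 * (p - 1)) (p / 2) * 2 ^ n * trf m (fun x => rpow x (p / 2)) V.
Proof.
intros Hp.
set (F := fun eps => trf m (fun x => rpow (Rabs x) p) (X eps)).
set (c := 2 * (p - 1)); set (tv := trf m (fun x => rpow x (p / 2)) V).
assert (E1 : lsum (bvecs n) F <= lsum (bvecs n) (fun eps => c * tf m (fun x => rpow (Rabs x) (p - 2)) (X eps) V)).
{ rewrite (lsum_ext _ F (fun eps => rsum n (fun j => sg eps j * tf m (fun x => spow x (p - 1)) (X eps) (A j))))
    by (intros; apply trf_abs_rpow_lin).
  rewrite <- rsum_lsum_swap.
  rewrite (lsum_ext _ _ (fun eps => rsum n (fun j => c * tf m (fun x => rpow (Rabs x) (p - 2)) (X eps) (msq m (A j))))).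
  2:{ intros eps _; rewrite tf_lin, <- rsum_scal; apply rsum_ext; intros; ring. }
  rewrite <- rsum_lsum_swap; apply rsum_le; intros j Hj; rewrite lsum_scal.
  now apply rademacher_flip_bound. }
assert (E2 : lsum (bvecs n) (fun eps => c * tf m (fun x => rpow (Rabs x) (p - 2)) (X eps) V) <=
  lsum (bvecs n) (fun eps => rpow c (p / 2) / (p / 2) * tv + (p / 2 - 1) / (p / 2) * F eps)).
{ apply lsum_le; intros eps _; apply tf_abs_young; unfold c; lra. }
rewrite lsum_plus, lsum_const, length_bvecs, (lsum_scal _ ((p / 2 - 1) / (p / 2)) F) in E2.
set (S := lsum (bvecs n) F) in *.
assert (E3 : S <= 2 ^ n * (rpow c (p / 2) / (p / 2) * tv) + (p / 2 - 1) / (p / 2) * S) by lra.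
apply (Rmult_le_compat_l (p / 2)) in E3; [|lra].
replace (p / 2 * (2 ^ n * (rpow c (p / 2) / (p / 2) * tv) + (p / 2 - 1) / (p / 2) * S))
  with (rpow c (p / 2) * 2 ^ n * tv + (p / 2 - 1) * S) in E3 by (field; lra).
lra.
Qed.

Lemma sg_orthogonal i j : (i < n)%nat -> (j < n)%nat ->
  lsum (bvecs n) (fun eps => sg eps i * sg eps j) = if Nat.eqb i j then 2 ^ n else 0.
Proof.
intros Hi Hj; destruct (Nat.eqb_spec i j) as [->|N].
- rewrite (lsum_ext _ _ (fun _ => 1)) by (intros; apply sg_sqr).
  rewrite lsum_const, length_bvecs; ring.
- assert (E := lsum_bvecs_flip n j (fun eps => sg eps i * sg eps j)).
  rewrite (lsum_ext _ _ (fun eps => -1 * (sg eps i * sg eps j))), lsum_scal in E; [lra|].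
  intros eps Heps; rewrite !sg_flip by (rewrite (bvecs_length n eps); auto).
  rewrite Nat.eqb_refl; destruct (Nat.eqb_spec i j); [congruence|ring].
Qed.

Lemma bil_lsum_rademacher u :
  lsum (bvecs n) (fun eps => bil m (msq m (X eps)) u u) = 2 ^ n * bil m V u u.
Proof.
rewrite (lsum_ext _ _ (fun eps => rsum n (fun i => rsum n (fun j =>
   dot m (mv m (A j) u) (mv m (A i) u) * (sg eps i * sg eps j))))).
2:{ intros eps _; rewrite bil_msq by auto; rewrite dot_mv_lin_l; apply rsum_ext; intros i _.
    rewrite dot_comm, dot_mv_lin_l, <- rsum_scal; apply rsum_ext; intros; ring. }
rewrite <- rsum_lsum_swap, bil_lin, <- rsum_scal; apply rsum_ext; intros i Hi.
rewrite <- rsum_lsum_swap.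
rewrite (rsum_ext n _ (fun j => if Nat.eqb i j then 2 ^ n * dot m (mv m (A j) u) (mv m (A i) u) else 0)).
- rewrite (rsum_delta_l n (fun j => 2 ^ n * dot m (mv m (A j) u) (mv m (A i) u))) by auto.
  rewrite bil_msq by auto; ring.
- intros j Hj; rewrite lsum_scal, sg_orthogonal by auto; destruct (Nat.eqb i j); ring.
Qed.

Lemma tf_lsum_rademacher f Z :
  lsum (bvecs n) (fun eps => tf m f Z (msq m (X eps))) = 2 ^ n * tf m f Z V.
Proof.
unfold tf; rewrite <- rsum_lsum_swap, <- rsum_scal; apply rsum_ext; intros i _.
rewrite lsum_scal, bil_lsum_rademacher; ring.
Qed.

(** The cross terms [eps_i eps_j] cancel, so [V] is the mean of the [X^2] and
    [tr V^q = tr (V^(q-1) V)] is the mean of [tr (V^(q-1) X^2)]. Young's inequality and absorption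
    then yield Jensen's inequality. *)
Theorem khintchine_lower p : 2 <= p ->
  2 ^ n * trf m (fun x => rpow x (p / 2)) V <=
  lsum (bvecs n) (fun eps => trf m (fun x => rpow (Rabs x) p) (X eps)).
Proof.
intros Hp.
set (F := fun eps => trf m (fun x => rpow (Rabs x) p) (X eps)).
set (q := p / 2); set (tv := trf m (fun x => rpow x q) V).
assert (Hq : 1 <= q) by (unfold q; lra).
assert (E0 : tf m (fun x => rpow x (q - 1)) V V = tv).
{ rewrite tf_self by auto; apply trf_ext; intros i Hi; apply rpow_pred; now apply evl_ge0. }
assert (E : lsum (bvecs n) (fun eps => tf m (fun x => rpow x (q - 1)) V (msq m (X eps))) <=
   lsum (bvecs n) (fun eps => / q * F eps + (q - 1) / q * tv)).
{ apply lsum_le; intros eps _.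
  assert (sq : msym m (msq m (X eps))) by now apply msym_msq.
  replace (F eps) with (trf m (fun x => rpow x q) (msq m (X eps))).
  2:{ rewrite trf_msq by auto; apply trf_ext; intros i _.
      replace (evl m (X eps) i * evl m (X eps) i) with (Rabs (evl m (X eps) i) * Rabs (evl m (X eps) i)).
      - rewrite rpow_mul by apply Rabs_pos; rewrite <- rpow_plus; f_equal; unfold q; field.
      - rewrite <- Rabs_mult; apply Rabs_pos_eq, Rle_0_sqr. }
  unfold tv, trf; rewrite <- !rsum_scal.
  apply (tf_young m V (msq m (X eps)) (fun x => rpow x (q - 1)) (fun x => / q * rpow x q)
    (fun x => (q - 1) / q * rpow x q)); auto.
  intros i j Hi Hj.
  assert (Y := young (evl m (msq m (X eps)) j) (evl m V i) q Hq
    (evl_ge0 m _ j sq (psd_msq m _ (symX eps)) Hj) (evl_ge0 m V i symV psdV Hi)).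
  unfold Rdiv in *; lra. }
rewrite tf_lsum_rademacher, E0, lsum_plus, (lsum_scal _ (/ q) F), lsum_const, length_bvecs in E.
apply (Rmult_le_compat_l q) in E; [|lra].
replace (q * (/ q * lsum (bvecs n) F + 2 ^ n * ((q - 1) / q * tv)))
  with (lsum (bvecs n) F + (q - 1) * (2 ^ n * tv)) in E by (field; lra).
lra.
Qed.

End RademacherSums.

(** * Random selection of positive matrices *)

Definition indic (S : list bool) (j : nat) : R := if nth j S false then 1 else 0.

Lemma ksubsets_card n k S : In S (ksubsets n k) -> card S = k.
Proof. intros H; apply filter_In in H; now apply Nat.eqb_eq. Qed.

Lemma ksubsets_length n k S : In S (ksubsets n k) -> length S = n.
Proof. intros H; apply filter_In in H; now apply bvecs_length. Qed.

Lemma lsum_ksubsets n k F :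
  lsum (ksubsets n k) F = lsum (bvecs n) (fun S => if Nat.eqb (card S) k then F S else 0).
Proof. apply lsum_filter. Qed.

Lemma lsum_ksubsets_S0 n F :
  lsum (ksubsets (S n) 0) F = lsum (ksubsets n 0) (fun S => F (false :: S)).
Proof.
rewrite !lsum_ksubsets, lsum_bvecs_S.
rewrite (lsum_ext _ _ (fun _ => 0)), lsum_zero, Rplus_0_l; auto.
Qed.

Lemma lsum_ksubsets_SS n k F :
  lsum (ksubsets (S n) (S k)) F =
  lsum (ksubsets n k) (fun S => F (true :: S)) + lsum (ksubsets n (S k)) (fun S => F (false :: S)).
Proof. rewrite !lsum_ksubsets, lsum_bvecs_S; reflexivity. Qed.

Definition nks (n k : nat) : R := lsum (ksubsets n k) (fun _ => 1).

Lemma nks_0 n : nks n 0 = 1.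
Proof.
induction n as [|n IH]; [unfold nks; rewrite lsum_ksubsets; cbn; ring|].
unfold nks; now rewrite lsum_ksubsets_S0.
Qed.

Lemma nks_SS n k : nks (S n) (S k) = nks n k + nks n (S k).
Proof. apply lsum_ksubsets_SS. Qed.

Lemma nks_gt n k : (n < k)%nat -> nks n k = 0.
Proof.
revert k; induction n as [|n IH]; intros [|k] H; try lia.
- unfold nks; rewrite lsum_ksubsets; cbn; ring.
- rewrite nks_SS, !IH by lia; ring.
Qed.

Lemma nks_binomial n k : (k <= n)%nat -> nks n k = Binomial.C n k.
Proof.
revert k; induction n as [|n IH]; intros [|k] H; try lia.
- rewrite nks_0; unfold Binomial.C; simpl; field.
- rewrite nks_0; unfold Binomial.C; rewrite Nat.sub_0_r; change (fact 0) with 1%nat; rewrite INR_1.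
  field; apply INR_fact_neq_0.
- rewrite nks_SS; destruct (Nat.eq_dec k n) as [->|N].
  + rewrite (nks_gt n (S n)), IH by lia.
    unfold Binomial.C; rewrite !Nat.sub_diag; change (fact 0) with 1%nat; rewrite INR_1.
    field; split; apply INR_fact_neq_0.
  + rewrite !IH by lia; apply pascal; lia.
Qed.

Lemma nks_ge0 n k : 0 <= nks n k.
Proof. apply lsum_nonneg; intros; lra. Qed.

Lemma lsum_ksubsets_ind n k j : (j <= n)%nat ->
  lsum (ksubsets (S n) (S k)) (fun S => indic S j) = nks n k.
Proof.
revert k j; induction n as [|n IH]; intros k j Hj; rewrite lsum_ksubsets_SS; destruct j as [|j]; try lia.
- unfold indic; cbn [nth]; rewrite lsum_zero, Rplus_0_r; reflexivity.
- unfold indic; cbn [nth]; rewrite lsum_zero, Rplus_0_r; reflexivity.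
- change (lsum (ksubsets (S n) k) (fun S => indic S j) + lsum (ksubsets (S n) (S k)) (fun S => indic S j) = nks (S n) k).
  rewrite IH by lia; destruct k as [|k].
  + rewrite !nks_0, (lsum_ext _ _ (fun _ => 0)); [rewrite lsum_zero; ring|].
    intros S HS; apply ksubsets_card in HS; unfold indic.
    destruct (nth j S false) eqn:E; auto.
    rewrite (card_flip_true _ _ E) in HS; discriminate.
  + rewrite IH by lia; now rewrite nks_SS.
Qed.

Lemma rsum_ind S : rsum (length S) (indic S) = INR (card S).
Proof.
induction S as [|b S IH]; [reflexivity|].
change (length (b :: S)) with (1 + length S)%nat; rewrite rsum_split, card_cons, plus_INR, <- IH.
rewrite rsum_S, rsum_0; unfold indic; destruct b; simpl; ring.
Qed.

Lemma lsum_ksubsets_marginal n k j : (j < n)%nat -> (1 <= k)%nat ->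
  lsum (ksubsets n k) (fun S => indic S j) = INR k / INR n * nks n k.
Proof.
intros Hj Hk; destruct n as [|n]; [lia|]; destruct k as [|k]; [lia|].
rewrite lsum_ksubsets_ind by lia.
assert (E : INR (S n) * nks n k = INR (S k) * nks (S n) (S k)).
{ rewrite <- rsum_const.
  rewrite (rsum_ext _ _ (fun j => lsum (ksubsets (S n) (S k)) (fun S => indic S j)))
    by (intros; now rewrite lsum_ksubsets_ind by lia).
  rewrite rsum_lsum_swap; unfold nks at 1; rewrite <- lsum_scal; apply lsum_ext; intros S HS.
  rewrite <- (ksubsets_length (Datatypes.S n) (Datatypes.S k) S) at 1 by auto.
  rewrite rsum_ind, (ksubsets_card _ _ _ HS); ring. }
assert (INR (S n) <> 0) by (apply not_0_INR; lia).
apply Rmult_eq_reg_l with (INR (S n)); auto; rewrite E; field; auto.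
Qed.

(* Pairs [(S, j)] with [j \in S] correspond to pairs [(R, j)] with [j \notin R] via [R = S \ j]. *)
Lemma ksubsets_double_count n k (F : nat -> list bool -> R) :
  lsum (ksubsets n (S k)) (fun S => rsum n (fun j => if nth j S false then F j (flip j S) else 0)) =
  lsum (ksubsets n k) (fun S => rsum n (fun j => if nth j S false then 0 else F j S)).
Proof.
rewrite <- !rsum_lsum_swap; apply rsum_ext; intros j Hj.
rewrite !lsum_ksubsets, <- (lsum_bvecs_flip n j).
apply lsum_ext; intros S HS.
assert (Hl : (j < length S)%nat) by (rewrite (bvecs_length n S); auto).
rewrite flip_flip, nth_flip, Nat.eqb_refl by auto.
destruct (nth j S false) eqn:E; cbn [negb].
- now destruct (Nat.eqb _ _), (Nat.eqb _ _).
- assert (E' : nth j (flip j S) false = true) by (rewrite nth_flip, Nat.eqb_refl, E; auto).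
  rewrite (card_flip_true _ _ E'), flip_flip; reflexivity.
Qed.

Lemma rsum_not_in S c : rsum (length S) (fun j => if nth j S false then 0 else c) =
  (INR (length S) - INR (card S)) * c.
Proof.
rewrite <- rsum_ind, Rmult_minus_distr_r, <- rsum_const, <- rsum_scal_r, <- rsum_minus.
apply rsum_ext; intros j _; unfold indic; destruct (nth j S false); ring.
Qed.

Lemma ksubsets_not_in n k (F : list bool -> R) :
  lsum (ksubsets n k) (fun S => rsum n (fun j => if nth j S false then 0 else F S)) =
  (INR n - INR k) * lsum (ksubsets n k) F.
Proof.
rewrite <- lsum_scal; apply lsum_ext; intros S HS.
rewrite <- (ksubsets_length n k S) at 1 2 by auto.
now rewrite rsum_not_in, (ksubsets_card _ _ _ HS).
Qed.

Lemma nks_pred n k : (INR n - INR k) * nks n k = INR (S k) * nks n (S k).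
Proof.
unfold nks; rewrite <- ksubsets_not_in.
rewrite <- (ksubsets_double_count n k (fun _ _ => 1)), <- lsum_scal.
apply lsum_ext; intros S HS; rewrite Rmult_1_r, <- (ksubsets_card _ _ _ HS), <- rsum_ind.
now rewrite (ksubsets_length _ _ _ HS).
Qed.

(** Although [x^q] is in general not operator monotone, its trace is monotone: [tr U^q = tr (U^(q-1)
    U) <= tr (U^(q-1) W)], followed by Young's inequality and absorption. *)
Lemma trf_rpow_monotone m q U W : 1 <= q -> msym m U -> msym m W -> psd m U -> psd m W ->
  (forall u, bil m U u u <= bil m W u u) ->
  trf m (fun x => rpow x q) U <= trf m (fun x => rpow x q) W.
Proof.
intros Hq symU symW psdU psdW ULW.
set (tU := trf m (fun x => rpow x q) U); set (tW := trf m (fun x => rpow x q) W).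
assert (E : tU = tf m (fun x => rpow x (q - 1)) U U).
{ rewrite tf_self by auto; apply trf_ext; intros i Hi; symmetry; apply rpow_pred; now apply evl_ge0. }
assert (L1 : tU <= tf m (fun x => rpow x (q - 1)) U W).
{ rewrite E; apply rsum_le; intros i _; apply Rmult_le_compat_l; auto; apply rpow_ge0. }
assert (L2 : tf m (fun x => rpow x (q - 1)) U W <= / q * tW + (q - 1) / q * tU).
{ unfold tU, tW, trf; rewrite <- !rsum_scal.
  apply (tf_young m U W (fun x => rpow x (q - 1)) (fun x => / q * rpow x q) (fun x => (q - 1) / q * rpow x q)); auto.
  intros i j Hi Hj.
  assert (Y := young _ _ q Hq (evl_ge0 m W j symW psdW Hj) (evl_ge0 m U i symU psdU Hi)).
  unfold Rdiv in *; lra. }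
assert (L3 := Rle_trans _ _ _ L1 L2).
apply (Rmult_le_compat_l q) in L3; [|lra].
replace (q * (/ q * tW + (q - 1) / q * tU)) with (tW + (q - 1) * tU) in L3 by (field; lra).
lra.
Qed.

(** * A Rosenthal bound for random subsums of positive matrices *)

Section SelectionOfPositiveMatrices.
Variables (m n : nat) (B : nat -> Mat) (q K1 K2 : R).
Hypotheses (symB : forall j, (j < n)%nat -> msym m (B j)) (psdB : forall j, (j < n)%nat -> psd m (B j)).
Hypotheses (q1 : 1 <= q) (K1_ge0 : 0 <= K1) (K2_ge1 : 1 <= K2).
(** Kept abstract because the concave and the convex case supply it with different [K1] and [K2]. *)
Hypothesis add_bound : forall Y C, msym m Y -> msym m C -> psd m Y -> psd m C ->
  tf m (fun x => rpow x (q - 1)) (madd Y C) C <=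
  K1 * trf m (fun x => rpow x q) C + K2 * tf m (fun x => rpow x (q - 1)) Y C.
Notation V S := (lin n (indic S) B).
Notation W := (lin n (fun _ => 1) B).
Notation trq := (trf m (fun x => rpow x q)).
Notation tfs := (tf m (fun x => rpow x (q - 1))).

Let symV c : msym m (lin n c B).
Proof. now apply msym_lin. Qed.

Let ind_ge0 S j : 0 <= indic S j.
Proof. unfold indic; destruct (nth j S false); lra. Qed.

Let psdV S : psd m (V S).
Proof. apply psd_lin; auto. Qed.

Let psdW : psd m W.
Proof. apply psd_lin; intros; split; [lra|auto]. Qed.

Let trq_ge0 X : 0 <= trq X.
Proof. apply rsum_nonneg; intros; apply rpow_ge0. Qed.

Lemma trq_le_total S : trq (V S) <= trq W.
Proof.
apply trf_rpow_monotone; auto.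
intros u; rewrite !bil_lin; apply rsum_le; intros j Hj; apply Rmult_le_compat_r.
- now apply psdB.
- unfold indic; destruct (nth j S false); lra.
Qed.

Lemma lin_ind_flip S j : (j < n)%nat -> length S = n -> nth j S false = true ->
  V S = madd (V (flip j S)) (B j).
Proof.
intros Hj Hl Hn; extensionality i; extensionality k; unfold lin, madd.
assert (E : B j i k = rsum n (fun l => if Nat.eqb l j then B l i k else 0))
  by now rewrite (rsum_delta n (fun l => B l i k)).
rewrite E, <- rsum_plus; apply rsum_ext; intros l Hl'.
unfold indic; rewrite nth_flip by lia; destruct (Nat.eqb_spec l j) as [->|]; [rewrite Hn; cbn [negb]|]; ring.
Qed.

Lemma trq_flip_le S j : (j < n)%nat -> length S = n -> nth j S false = true ->
  trq (V (flip j S)) <= trq (V S).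
Proof.
intros Hj Hl Hn; rewrite (lin_ind_flip S j) by auto.
apply trf_rpow_monotone; auto using msym_madd, psd_madd.
intros u; unfold madd; rewrite bil_plus; specialize (psdB j Hj u); lra.
Qed.

Lemma trq_selection_step S : length S = n ->
  trq (V S) <= K1 * rsum n (fun j => indic S j * trq (B j)) +
    K2 * rsum n (fun j => if nth j S false then tfs (V (flip j S)) (B j) else 0).
Proof.
intros HS.
replace (trq (V S)) with (tfs (V S) (V S)).
2:{ rewrite tf_self by auto; apply trf_ext; intros i Hi; apply rpow_pred; now apply evl_ge0. }
rewrite tf_lin, <- !rsum_scal, <- rsum_plus; apply rsum_le; intros j Hj.
unfold indic at 1 3; destruct (nth j S false) eqn:E; [|lra].
rewrite (lin_ind_flip S j) by auto; rewrite !Rmult_1_l; auto.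
Qed.

(** Removing an index lowers the trace. A [k]-set arises by removal from [n - k] pairs [(S, j)], and
    a [(k+1)]-set belongs to [k + 1] such pairs. *)
Lemma trq_pred_average k : (INR n - INR k) * lsum (ksubsets n k) (fun S => trq (V S)) <=
  INR (S k) * lsum (ksubsets n (S k)) (fun S => trq (V S)).
Proof.
rewrite <- ksubsets_not_in, <- (ksubsets_double_count n k (fun _ S => trq (V S))), <- lsum_scal.
apply lsum_le; intros S HS.
assert (Hl := ksubsets_length _ _ _ HS).
rewrite <- (ksubsets_card _ _ _ HS), <- rsum_ind, Hl, <- rsum_scal_r.
apply rsum_le; intros j Hj; unfold indic; destruct (nth j S false) eqn:E; [|lra].
rewrite Rmult_1_l; now apply trq_flip_le.
Qed.

Lemma tfs_total_young mu S : 0 < mu -> tfs (V S) W <= / mu * (rpow mu q * trq W + trq (V S)).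
Proof.
intros Hmu.
apply Rmult_le_reg_l with mu; auto; rewrite <- Rmult_assoc, Rinv_r, Rmult_1_l by lra.
rewrite <- tf_scal; unfold trf at 1; rewrite <- rsum_scal.
apply (tf_young m (V S) W (fun x => mu * rpow x (q - 1)) (fun x => rpow mu q * rpow x q) (fun x => rpow x q)); auto.
intros i j Hi Hj.
assert (Hw := evl_ge0 m W j (symV _) psdW Hj); assert (Hv := evl_ge0 m (V S) i (symV _) (psdV S) Hi).
set (w := evl m W j) in *; set (v := evl m (V S) i) in *.
assert (Y := young (mu * w) v q q1 (Rmult_le_pos _ _ (Rlt_le _ _ Hmu) Hw) Hv).
rewrite rpow_mul in Y by lra.
assert (P1 := rpow_ge0 v q).
assert (P2 : 0 <= rpow mu q * rpow w q) by (apply Rmult_le_pos; apply rpow_ge0).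
assert (iq : 0 < / q <= 1).
{ split; [apply Rinv_0_lt_compat; lra|rewrite <- Rinv_1; apply Rinv_le_contravar; lra]. }
replace ((q - 1) / q) with (1 - / q) in Y by (field; lra).
unfold Rdiv in Y; nra.
Qed.

(** Beyond [k = n/2] the bound by [tr W^q] suffices, as [mu >= 2]. Otherwise [R], the set [S]
    without [j], has [k - 1] elements and [j] ranges over its complement, where the [B j] sum to at
    most [W]. Young's inequality for [tr (W V_R^(q-1))] returns [tr V_R^q], whose sum over [R] is
    compared with [M]. *)
Theorem positive_selection_bound k : (1 <= k)%nat -> (k <= n)%nat ->
  lsum (ksubsets n k) (fun S => trq (V S)) <=
  nks n k * (2 * K1 * (INR k / INR n * rsum n (fun j => trq (B j))) +
             rpow (4 * (INR k / INR n) * K2) q * trq W).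
Proof.
intros Hk Hkn.
set (a := INR k / INR n); set (beta := rsum n (fun j => trq (B j))).
set (mu := 4 * a * K2); set (M := lsum (ksubsets n k) (fun S => trq (V S))).
assert (n0 : 0 < INR n) by (apply lt_0_INR; lia).
assert (k0 : 0 < INR k) by (apply lt_0_INR; lia).
assert (a0 : 0 < a) by (apply Rdiv_lt_0_compat; lra).
assert (beta0 : 0 <= beta) by (apply rsum_nonneg; auto).
assert (N0 := nks_ge0 n k); assert (W0 := trq_ge0 W).
assert (mu0 : 0 < mu) by (unfold mu; nra).
assert (Ka0 : 0 <= 2 * K1 * (a * beta)) by (apply Rmult_le_pos; [lra|apply Rmult_le_pos; lra]).
destruct (Rlt_le_dec (INR n) (2 * INR k)) as [Hbig|Hsmall].
- assert (a2 : / 2 <= a).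
  { unfold a; apply Rmult_le_reg_r with (INR n); auto; field_simplify; lra. }
  assert (mu1 : 1 <= rpow mu q).
  { replace 1 with (rpow 1 q).
    - apply rpow_le; [lra|unfold mu; nra].
    - rewrite rpow_pos, ln_1, Rmult_0_r by lra; apply exp_0. }
  apply Rle_trans with (nks n k * trq W).
  + unfold M, nks; rewrite <- lsum_scal_r; apply lsum_le; intros S _.
    rewrite Rmult_1_l; apply trq_le_total.
  + apply Rmult_le_compat_l; auto; nra.
- (* [mu] is chosen so that the term containing [M] on the right has coefficient [1/2] *)
  destruct k as [|k']; [lia|].
  set (Mr := lsum (ksubsets n k') (fun S => trq (V S))).
  assert (Mr0 : 0 <= Mr) by (apply lsum_nonneg; auto).
  (* Here [2 k <= n] enters: at least half of the indices lie outside a [(k-1)]-set, so both its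
     count and its trace sum are at most [2 a] times those for size [k]. *)
  assert (nk : INR n <= 2 * (INR n - INR k')) by (rewrite S_INR in Hsmall; lra).
  assert (HN : nks n k' <= 2 * a * nks n (S k')).
  { assert (E := nks_pred n k'); assert (Nr := nks_ge0 n k').
    apply Rmult_le_reg_l with (INR n); auto.
    replace (INR n * (2 * a * nks n (S k'))) with (2 * (INR (S k') * nks n (S k'))) by (unfold a; field; lra).
    rewrite <- E; nra. }
  assert (HM : Mr <= 2 * a * M).
  { assert (E := trq_pred_average k'); fold Mr M in E.
    apply Rmult_le_reg_l with (INR n); auto.
    replace (INR n * (2 * a * M)) with (2 * (INR (S k') * M)) by (unfold a; field; lra).
    nra. }
  assert (step1 : M <= K1 * (a * nks n (S k') * beta) +
     K2 * lsum (ksubsets n k') (fun S => tfs (V S) W)).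
  { apply Rle_trans with (lsum (ksubsets n (S k')) (fun S =>
       K1 * rsum n (fun j => indic S j * trq (B j)) +
       K2 * rsum n (fun j => if nth j S false then tfs (V (flip j S)) (B j) else 0))).
    - apply lsum_le; intros S HS; apply trq_selection_step; now apply ksubsets_length in HS.
    - rewrite lsum_plus, !lsum_scal; apply Rplus_le_compat; apply Rmult_le_compat_l; try lra.
      + apply Req_le; rewrite <- rsum_lsum_swap; unfold beta; rewrite <- rsum_scal.
        apply rsum_ext; intros j Hj; rewrite lsum_scal_r.
        now rewrite lsum_ksubsets_marginal by auto.
      (* The terms with [j] in the smaller set are nonnegative; restoring them completes the sum of
         the [B j] to [W]. *)
      + rewrite (ksubsets_double_count n k' (fun j S => tfs (V S) (B j))).
        apply lsum_le; intros S HS; rewrite tf_lin; apply rsum_le; intros j Hj.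
        assert (0 <= tfs (V S) (B j)) by (apply tf_ge0; auto; intros; apply rpow_ge0).
        destruct (nth j S false); lra. }
  assert (step2 : lsum (ksubsets n k') (fun S => tfs (V S) W) <=
     / mu * (nks n k' * (rpow mu q * trq W) + Mr)).
  { unfold nks, Mr; rewrite <- lsum_scal_r, <- lsum_plus, <- lsum_scal.
    apply lsum_le; intros S _; rewrite Rmult_1_l; now apply tfs_total_young. }
  assert (R0 : 0 <= rpow mu q * trq W) by (apply Rmult_le_pos; auto; apply rpow_ge0).
  set (r := rpow mu q * trq W) in *; set (N := nks n (S k')) in *.
  assert (step3 : K2 * (/ mu * (nks n k' * r + Mr)) <= / 2 * (N * r + M)).
  { replace (/ 2 * (N * r + M)) with (K2 * (/ mu * (2 * a * N * r + 2 * a * M)))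
      by (unfold mu; field; lra).
    apply Rmult_le_compat_l; [lra|]; apply Rmult_le_compat_l; [left; now apply Rinv_0_lt_compat|].
    apply Rplus_le_compat; auto; now apply Rmult_le_compat_r. }
  assert (step4 := Rmult_le_compat_l K2 _ _ ltac:(lra) step2).
  replace (N * (2 * K1 * (a * beta) + r)) with (2 * (K1 * (a * N * beta)) + N * r) by ring.
  lra.
Qed.

End SelectionOfPositiveMatrices.

(** * Schatten norms and the symmetric dilation *)

Definition gram (d : nat) (A : Mat) : Mat := mmul d (mtr A) A.

Lemma msym_gram d A : msym d (gram d A).
Proof. intros i j _ _; apply rsum_ext; intros; unfold mtr; ring. Qed.

Lemma mmul_diag d Q lam k l : (k < d)%nat -> (l < d)%nat ->
  mmul d (mmul d Q (mdiag lam)) (mtr Q) k l = rsum d (fun r => lam r * (Q k r * Q l r)).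
Proof.
intros Hk Hl; apply rsum_ext; intros r Hr; unfold mmul at 1, mdiag, mtr.
rewrite (rsum_ext d _ (fun t => if Nat.eqb t r then Q k t * lam t else 0))
  by (intros t _; destruct (Nat.eqb t r); ring).
rewrite (rsum_delta d (fun t => Q k t * lam t)) by auto; ring.
Qed.

Lemma mtrace_diag d Q lam : orthogonal d Q ->
  mtrace d (mmul d (mmul d Q (mdiag lam)) (mtr Q)) = rsum d lam.
Proof.
intros HQ; unfold mtrace.
rewrite (rsum_ext d _ (fun k => rsum d (fun r => lam r * (Q k r * Q k r)))) by (intros; now apply mmul_diag).
rewrite rsum_swap; apply rsum_ext; intros r Hr; rewrite rsum_scal.
assert (E := HQ r r Hr Hr); unfold mmul, mtr, mdiag in E; rewrite Nat.eqb_refl in E; rewrite E; ring.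
Qed.

Lemma diagonalization_spec d G Q lam : orthogonal d Q ->
  meq d G (mmul d (mmul d Q (mdiag lam)) (mtr Q)) -> spec d G (fun i k => Q k i) lam.
Proof.
intros HQ HG; split; [|split].
- intros i j Hi Hj; assert (E := HQ i j Hi Hj); exact E.
- intros k l Hk Hl; now apply RealSpectral.orthonormal_complete.
- intros i k Hi Hk; unfold mv.
  rewrite (rsum_ext d _ (fun l => rsum d (fun r => lam r * Q k r * (Q l r * Q l i)))).
  2:{ intros l Hl; rewrite HG, mmul_diag, <- rsum_scal_r by auto; apply rsum_ext; intros; ring. }
  rewrite rsum_swap.
  rewrite (rsum_ext d _ (fun r => if Nat.eqb r i then lam r * Q k r else 0)).
  + now rewrite (rsum_delta d (fun r => lam r * Q k r)).
  + intros r Hr; rewrite rsum_scal.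
    assert (E := HQ r i Hr Hi); unfold mmul, mtr, mdiag in E; rewrite E; destruct (Nat.eqb r i); ring.
Qed.

Lemma spec_diagonalization d G e x : spec d G e x ->
  orthogonal d (fun k i => e i k) /\
  meq d G (mmul d (mmul d (fun k i => e i k) (mdiag x)) (mtr (fun k i => e i k))).
Proof.
intros HS; destruct (HS) as (H1 & H2 & H3); split.
- intros i j Hi Hj; unfold mmul, mtr, mdiag; rewrite <- (H1 i j) by auto; reflexivity.
- intros k l Hk Hl; rewrite mmul_diag by auto.
  transitivity (rsum d (fun j => G k j * (if Nat.eqb j l then 1 else 0))).
  + rewrite (rsum_ext d _ (fun j => if Nat.eqb j l then G k j else 0)).
    * now rewrite (rsum_delta d (fun j => G k j)).
    * intros j _; destruct (Nat.eqb j l); ring.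
  + rewrite (rsum_ext d _ (fun j => rsum d (fun r => G k j * e r j * e r l))).
    * rewrite rsum_swap; apply rsum_ext; intros r Hr; rewrite rsum_scal_r.
      change (rsum d (fun i => G k i * e r i)) with (mv d G (e r) k); rewrite H3 by auto; ring.
    * intros j Hj; rewrite <- H2, <- rsum_scal by auto; apply rsum_ext; intros; ring.
Qed.

(** A diagonalisation exists, so [epsilon] returns the value of one of them, and by [trf_spec] all
    of them give the same value. *)
Lemma schatten_trace_trf d p A : schatten_trace d p A = trf d (fun x => rpow x (p / 2)) (gram d A).
Proof.
unfold schatten_trace.
match goal with |- epsilon _ ?P = _ => assert (H : P (epsilon (inhabits 0) P)) end.
{ apply epsilon_spec.
  destruct (RealSpectral.spectral_theorem d _ (msym_gram d A)) as (e & x & HS).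
  destruct (spec_diagonalization _ _ _ _ HS) as (H1 & H2).
  eexists; exists (fun k i => e i k), x; split; [|split]; [exact H1|exact H2|reflexivity]. }
destruct H as (Q & lam & HQ & HG & ->).
rewrite mtrace_diag by auto; symmetry.
apply (trf_spec d (gram d A) (fun i k => Q k i) lam (fun x => rpow x (p / 2)));
  [apply msym_gram|now apply diagonalization_spec].
Qed.

Lemma schatten_norm_pow d p A : 2 <= p -> rpow (schatten_norm d p A) p = schatten_trace d p A.
Proof.
intros Hp; unfold schatten_norm; rewrite rpow_mult.
replace (1 / p * p) with 1 by (field; lra).
apply rpow_1; rewrite schatten_trace_trf; apply rsum_nonneg; intros; apply rpow_ge0.
Qed.

(* The symmetric dilation [[0, A], [A^T, 0]]. *)
Definition dil (d : nat) (A : Mat) : Mat := fun i j =>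
  if Nat.ltb i d then (if Nat.ltb j d then 0 else A i (j - d)%nat)
  else (if Nat.ltb j d then A j (i - d)%nat else 0).

Lemma msym_dil d A : msym (d + d) (dil d A).
Proof.
intros i j _ _; unfold mtr, dil; destruct (Nat.ltb i d), (Nat.ltb j d); reflexivity.
Qed.

Lemma dil_lin d n c A : dil d (lin n c A) = lin n c (fun j => dil d (A j)).
Proof.
extensionality i; extensionality j; unfold dil, lin.
assert (Z : 0 = rsum n (fun l => c l * 0)).
{ rewrite (rsum_ext n _ (fun _ => 0)), rsum_zero; auto; intros; ring. }
destruct (Nat.ltb i d), (Nat.ltb j d); auto.
Qed.

Lemma dot_split d u v : dot (d + d) u v =
  dot d u v + dot d (fun k => u (d + k)%nat) (fun k => v (d + k)%nat).
Proof. unfold dot; now rewrite rsum_split. Qed.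

Lemma mv_dil_top d A u k : (k < d)%nat -> mv (d + d) (dil d A) u k = mv d A (fun l => u (d + l)%nat) k.
Proof.
intros Hk; unfold mv; rewrite rsum_split, (rsum_ext d _ (fun _ => 0)), rsum_zero, Rplus_0_l.
- apply rsum_ext; intros j Hj; unfold dil.
  destruct (Nat.ltb_spec k d), (Nat.ltb_spec (d + j) d); try lia.
  now replace (d + j - d)%nat with j by lia.
- intros j Hj; unfold dil; destruct (Nat.ltb_spec k d), (Nat.ltb_spec j d); try lia; ring.
Qed.

Lemma mv_dil_bottom d A u k : (k < d)%nat -> mv (d + d) (dil d A) u (d + k)%nat = mv d (mtr A) u k.
Proof.
intros Hk; unfold mv; rewrite rsum_split, (rsum_ext d (fun j => dil d A _ (d + j)%nat * _) (fun _ => 0)), rsum_zero, Rplus_0_r.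
- apply rsum_ext; intros j Hj; unfold dil, mtr.
  destruct (Nat.ltb_spec (d + k) d), (Nat.ltb_spec j d); try lia.
  now replace (d + k - d)%nat with k by lia.
- intros j Hj; unfold dil; destruct (Nat.ltb_spec (d + k) d), (Nat.ltb_spec (d + j) d); try lia; ring.
Qed.

Lemma dot_mv_transpose d A u v : dot d u (mv d A v) = dot d (mv d (mtr A) u) v.
Proof.
unfold dot, mv.
rewrite (rsum_ext d _ (fun i => rsum d (fun j => u i * A i j * v j)))
  by (intros; rewrite <- rsum_scal; apply rsum_ext; intros; ring).
rewrite rsum_swap; apply rsum_ext; intros j _; rewrite <- rsum_scal_r.
apply rsum_ext; intros; unfold mtr; ring.
Qed.

(* With [e i = (f, g)]: [x |f|^2 = <f, A g> = <A^T f, g> = x |g|^2] and [|f|^2 + |g|^2 = 1]. *)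
Lemma dil_eigenvector_half d A e x i : spec (d + d) (dil d A) e x -> (i < d + d)%nat -> x i <> 0 ->
  dot d (fun k => e i (d + k)%nat) (fun k => e i (d + k)%nat) = / 2.
Proof.
intros HS Hi Hx; destruct (HS) as (orth & _ & eig).
set (g := fun k => e i (d + k)%nat).
assert (Hn : dot d (e i) (e i) + dot d g g = 1).
{ rewrite <- (spec_norm _ _ _ _ HS i Hi); symmetry; apply dot_split. }
assert (Ef : dot d (e i) (mv d A g) = x i * dot d (e i) (e i)).
{ rewrite <- dot_scal_l, dot_comm; apply dot_ext; auto.
  intros k Hk; rewrite <- eig, mv_dil_top by lia; reflexivity. }
assert (Eg : dot d (mv d (mtr A) (e i)) g = x i * dot d g g).
{ rewrite <- dot_scal_l; apply dot_ext; auto.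
  intros k Hk; unfold g; rewrite <- eig, mv_dil_bottom by lia; reflexivity. }
rewrite dot_mv_transpose, Eg in Ef.
apply Rmult_eq_reg_l in Ef; auto; lra.
Qed.

Definition pad (d : nat) (u : nat -> R) : nat -> R := fun k => if Nat.ltb k d then 0 else u (k - d)%nat.

Lemma pad_top d u k : (k < d)%nat -> pad d u k = 0.
Proof. intros Hk; unfold pad; destruct (Nat.ltb_spec k d); [auto|lia]. Qed.

Lemma pad_bottom d u k : pad d u (d + k)%nat = u k.
Proof.
unfold pad; destruct (Nat.ltb_spec (d + k) d); [lia|].
now replace (d + k - d)%nat with k by lia.
Qed.

Lemma dot_pad d u v : dot (d + d) (pad d u) v = dot d u (fun k => v (d + k)%nat).
Proof.
rewrite dot_split, (dot_ext d (pad d u) (fun _ => 0) v v) by auto using pad_top.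
unfold dot at 1; rewrite (rsum_ext d _ (fun _ => 0)), rsum_zero, Rplus_0_l by (intros; ring).
apply dot_ext; auto; intros; apply pad_bottom.
Qed.

Lemma mv_dil_sqr_pad d A u k : (k < d + d)%nat ->
  mv (d + d) (dil d A) (mv (d + d) (dil d A) (pad d u)) k = pad d (mv d (gram d A) u) k.
Proof.
intros Hk; destruct (Nat.lt_ge_cases k d) as [H|H].
- rewrite pad_top, mv_dil_top by auto; unfold mv at 1.
  rewrite (rsum_ext d _ (fun _ => 0)), rsum_zero; auto.
  intros j Hj; rewrite mv_dil_bottom by auto; unfold mv.
  rewrite (rsum_ext d _ (fun _ => 0)), rsum_zero by (intros; rewrite pad_top by auto; ring); ring.
- replace k with (d + (k - d))%nat by lia.
  rewrite pad_bottom, mv_dil_bottom by lia; unfold gram; rewrite mv_mmul.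
  apply rsum_ext; intros j Hj; rewrite mv_dil_top by auto; f_equal.
  apply rsum_ext; intros; now rewrite pad_bottom.
Qed.

(** The nonzero eigenvalues of the dilation are plus and minus the singular values. Let [g_i] be the
    lower half of an eigenvector of it. Its square acts on [(0, u)] as [A^T A], so the weights
    [<u_l, g_i>^2] live on [lam_l = x_i^2]. They sum over [i] to [|(0, u_l)|^2 = 1] and over [l] to
    [|g_i|^2 = 1/2], unless [x_i = 0] and the term vanishes; hence the factor 2. *)
Theorem trf_dil d p A : 2 <= p ->
  trf (d + d) (fun x => rpow (Rabs x) p) (dil d A) = 2 * trf d (fun x => rpow x (p / 2)) (gram d A).
Proof.
intros Hp.
set (X := dil d A); set (G := gram d A).
assert (symX : msym (d + d) X) by apply msym_dil.
assert (symG : msym d G) by apply msym_gram.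
assert (HX := eigsys_spec _ _ symX); assert (HG := eigsys_spec _ _ symG).
set (e := evec (d + d) X) in *; set (x := evl (d + d) X) in *.
set (u := evec d G) in *; set (lam := evl d G) in *.
set (g := fun i k => e i (d + k)%nat).
assert (key : forall i l, (i < d + d)%nat -> (l < d)%nat ->
  dot d (u l) (g i) * dot d (u l) (g i) * rpow (lam l) (p / 2) =
  dot d (u l) (g i) * dot d (u l) (g i) * rpow (Rabs (x i)) p).
{ intros i l Hi Hl.
  assert (E : x i * (x i * dot d (u l) (g i)) = lam l * dot d (u l) (g i)).
  { change (dot d (u l) (g i)) with (dot d (u l) (fun k => e i (d + k)%nat)).
    rewrite <- dot_pad, <- !(spec_mv_dot _ _ _ _ symX HX) by auto.
    unfold X; rewrite (dot_ext _ _ _ _ _ (mv_dil_sqr_pad d A (u l)) (fun k _ => eq_refl (e i k))).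
    rewrite !dot_pad, <- dot_scal_l; apply dot_ext; auto.
    destruct HG as (_ & _ & eig); intros; now apply eig. }
  destruct (Req_dec (dot d (u l) (g i)) 0) as [->|N]; [ring|].
  assert (lam l = x i * x i) as ->.
  { apply Rmult_eq_reg_r with (dot d (u l) (g i)); auto; lra. }
  f_equal; rewrite <- (Rabs_pos_eq (x i * x i)) by apply Rle_0_sqr.
  rewrite Rabs_mult, rpow_mul by apply Rabs_pos; rewrite <- rpow_plus; f_equal; field. }
assert (E1 : trf d (fun y => rpow y (p / 2)) G = rsum d (fun l => rsum (d + d) (fun i =>
  dot d (u l) (g i) * dot d (u l) (g i) * rpow (Rabs (x i)) p))).
{ apply rsum_ext; intros l Hl.
  rewrite <- (rsum_ext _ _ _ (fun i Hi => key i l Hi Hl)), rsum_scal_r.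
  rewrite (rsum_ext (d + d) _ (fun i => dot (d + d) (pad d (u l)) (e i) * dot (d + d) (pad d (u l)) (e i)))
    by (intros; now rewrite dot_pad).
  rewrite <- (spec_parseval _ _ _ _ HX), dot_pad.
  rewrite (dot_ext d _ (u l) _ (u l)) by (auto; intros; apply pad_bottom).
  rewrite (spec_norm _ _ _ _ HG l Hl), Rmult_1_l; reflexivity. }
rewrite E1, rsum_swap, <- rsum_scal; apply rsum_ext; intros i Hi.
rewrite rsum_scal_r.
rewrite (rsum_ext d _ (fun l => dot d (g i) (u l) * dot d (g i) (u l))) by (intros; now rewrite (dot_comm d (g i))).
rewrite <- (spec_parseval _ _ _ _ HG).
fold x; destruct (Req_dec (x i) 0) as [->|N].
- rewrite Rabs_R0, rpow_npos by lra; ring.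
- change (g i) with (fun k => e i (d + k)%nat).
  rewrite (dil_eigenvector_half d A e x i HX Hi N); unfold x; field.
Qed.

Lemma schatten_norm_pow_dil d p A : 2 <= p ->
  trf (d + d) (fun x => rpow (Rabs x) p) (dil d A) = 2 * rpow (schatten_norm d p A) p.
Proof. intros Hp; rewrite schatten_norm_pow, schatten_trace_trf by auto; now apply trf_dil. Qed.

Lemma signed_sum_lin n A S eps :
  signed_sum n A S eps = lin n (sg eps) (fun j i k => indic S j * A j i k).
Proof.
extensionality i; extensionality k; apply rsum_ext; intros j _.
unfold indic, sg; destruct (nth j S false); ring.
Qed.

Lemma dil_signed_sum d n A S eps :
  dil d (signed_sum n A S eps) = lin n (sg eps) (fun j i k => indic S j * dil d (A j) i k).
Proof.
rewrite signed_sum_lin, dil_lin; extensionality i; extensionality k.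
apply rsum_ext; intros j _; f_equal; unfold dil.
destruct (Nat.ltb i d), (Nat.ltb k d); ring.
Qed.

Lemma lin_msq_ind m n A S :
  lin n (fun _ => 1) (fun j => msq m (fun i k => indic S j * A j i k)) = lin n (indic S) (fun j => msq m (A j)).
Proof.
extensionality i; extensionality k; apply rsum_ext; intros j _.
rewrite msq_scal; unfold indic; destruct (nth j S false); ring.
Qed.

Lemma ind_repeat_true n j : (j < n)%nat -> indic (repeat true n) j = 1.
Proof. intros Hj; unfold indic; now rewrite nth_repeat_lt. Qed.

(** * Return from traces of dilations to Schatten norms *)

Section SchattenNorms.
Variables (d n : nat) (A : nat -> Mat) (p : R).
Hypothesis p2 : 2 <= p.
Notation q := (p / 2).
Notation m := (d + d)%nat.
Notation D := (fun j => dil d (A j)).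
Notation pn := (fun X => rpow (schatten_norm d p X) p).
Notation V S := (lin n (indic S) (fun j => msq m (D j))).
Notation W := (lin n (fun _ => 1) (fun j => msq m (D j))).
Notation trq := (trf m (fun x => rpow x q)).

Lemma selected_khintchine S :
  2 * lsum (bvecs n) (fun eps => pn (signed_sum n A S eps)) <=
  rpow (2 * (p - 1)) q * 2 ^ n * trq (V S).
Proof.
rewrite <- lsum_scal, <- lin_msq_ind.
rewrite (lsum_ext _ _ (fun eps => trf m (fun x => rpow (Rabs x) p)
   (lin n (sg eps) (fun j i k => indic S j * dil d (A j) i k)))).
- apply khintchine_upper; auto; intros j _; apply msym_scal, msym_dil.
- intros eps _; rewrite <- schatten_norm_pow_dil by auto; now rewrite dil_signed_sum.
Qed.

Lemma full_khintchine :
  2 ^ n * trq W <= 2 * lsum (bvecs n) (fun eps => pn (signed_sum n A (repeat true n) eps)).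
Proof.
rewrite <- lsum_scal.
rewrite (lsum_ext _ _ (fun eps => trf m (fun x => rpow (Rabs x) p) (lin n (sg eps) D))).
- apply khintchine_lower; auto; intros; apply msym_dil.
- intros eps _; rewrite <- schatten_norm_pow_dil, dil_signed_sum by auto.
  f_equal; extensionality i; extensionality k; apply rsum_ext; intros j Hj.
  rewrite ind_repeat_true by auto; ring.
Qed.

Lemma trq_msq_dil j : trq (msq m (D j)) = 2 * pn (A j).
Proof.
cbv beta; rewrite <- schatten_norm_pow_dil, trf_msq by auto using msym_dil.
apply trf_ext; intros i _.
rewrite <- (Rabs_pos_eq (evl m (dil d (A j)) i * evl m (dil d (A j)) i)) by apply Rle_0_sqr.
rewrite Rabs_mult, rpow_mul by apply Rabs_pos; rewrite <- rpow_plus; f_equal; field.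
Qed.

(** Khintchine for each fixed [S], then the selection bound with the positive matrices [D_j^2], then
    the converse Khintchine for the full sum. Dilation doubles every Schatten term, so the factors 2
    cancel. The two hypotheses on [c] isolate the numerical part. *)
Lemma selection_bound k kappa K1 K2 c : (1 <= k)%nat -> (k <= n)%nat -> 0 <= kappa -> 0 <= K1 -> 1 <= K2 ->
  (forall Y C, msym m Y -> msym m C -> psd m Y -> psd m C ->
    tf m (fun x => rpow x (q - 1)) (madd Y C) C <=
    K1 * trf m (fun x => rpow x q) C + K2 * tf m (fun x => rpow x (q - 1)) Y C) ->
  kappa * rpow (2 * (p - 1)) q * (2 * K1) <= c ->
  kappa * rpow (2 * (p - 1)) q * rpow (4 * K2) q <= c ->
  kappa / (2 ^ n * Binomial.C n k) *
    lsum (ksubsets n k) (fun S => lsum (bvecs n) (fun eps => pn (signed_sum n A S eps))) <=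
  c * (INR k / INR n * rsum n (fun j => pn (A j)) +
       Rpower (INR k / INR n) q / 2 ^ n *
         lsum (bvecs n) (fun eps => pn (signed_sum n A (repeat true n) eps))).
Proof.
intros Hk Hkn Hkap HK1 HK2 add_bound Hc1 Hc2.
assert (n0 : 0 < INR n) by (apply lt_0_INR; lia).
assert (k0 : 0 < INR k) by (apply lt_0_INR; lia).
set (a := INR k / INR n); assert (a0 : 0 < a) by (apply Rdiv_lt_0_compat; lra).
set (c1 := rpow (2 * (p - 1)) q) in *.
assert (c10 : 0 <= c1) by apply rpow_ge0.
set (Tot := lsum (ksubsets n k) (fun S => lsum (bvecs n) (fun eps => pn (signed_sum n A S eps)))).
set (be := rsum n (fun j => pn (A j))).
set (ta := lsum (bvecs n) (fun eps => pn (signed_sum n A (repeat true n) eps))).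
assert (be0 : 0 <= be) by (apply rsum_nonneg; intros; apply rpow_ge0).
assert (ta0 : 0 <= ta) by (apply lsum_nonneg; intros; apply rpow_ge0).
assert (N0 : 0 < Binomial.C n k).
{ unfold Binomial.C; apply Rdiv_lt_0_compat; [|apply Rmult_lt_0_compat]; apply INR_fact_lt_0. }
assert (P0 : 0 < 2 ^ n) by (apply pow_lt; lra).
assert (E1 : 2 * Tot <= c1 * 2 ^ n * lsum (ksubsets n k) (fun S => trq (V S))).
{ unfold Tot; rewrite <- !lsum_scal; apply lsum_le; intros S _; apply selected_khintchine. }
assert (E2 := positive_selection_bound m n (fun j => msq m (D j)) q K1 K2
  (fun j _ => msym_msq m _ (msym_dil d (A j))) (fun j _ => psd_msq m _ (msym_dil d (A j)))
  ltac:(lra) HK1 HK2 add_bound k Hk Hkn).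
rewrite nks_binomial in E2 by auto; fold a in E2.
rewrite (rsum_ext n _ (fun j => 2 * pn (A j))), rsum_scal in E2 by (intros; apply trq_msq_dil).
fold be in E2.
assert (E3 := full_khintchine); fold ta in E3.
replace (4 * a * K2) with (a * (4 * K2)) in E2 by ring.
rewrite rpow_mul in E2 by lra.
set (N := Binomial.C n k) in *; set (r4 := rpow (4 * K2) q) in *; set (ra := rpow a q) in *.
assert (ra0 : 0 <= ra) by apply rpow_ge0; assert (r40 : 0 <= r4) by apply rpow_ge0.
assert (E4 : trq W <= 2 * (/ 2 ^ n * ta)).
{ apply Rmult_le_reg_l with (2 ^ n); auto.
  replace (2 ^ n * (2 * (/ 2 ^ n * ta))) with (2 * ta) by (field; lra); exact E3. }
set (t := / 2 ^ n * ta) in *.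
assert (t0 : 0 <= t) by (apply Rmult_le_pos; auto; left; now apply Rinv_0_lt_compat).
assert (E5 : Tot <= c1 * 2 ^ n * (N * (2 * K1 * (a * be) + ra * r4 * t))).
{ assert (ra * r4 * trq W <= ra * r4 * (2 * t)) by (apply Rmult_le_compat_l; auto; now apply Rmult_le_pos).
  assert (N * (2 * K1 * (a * (2 * be)) + ra * r4 * trq W) <= N * (2 * (2 * K1 * (a * be) + ra * r4 * t)))
    by (apply Rmult_le_compat_l; lra).
  assert (E6 := Rle_trans _ _ _ E2 H0).
  assert (H1 : 0 <= c1 * 2 ^ n) by (apply Rmult_le_pos; lra).
  apply (Rmult_le_compat_l _ _ _ H1) in E6; lra. }
replace (Rpower a q / 2 ^ n * ta) with (ra * t).
2:{ unfold ra, t; rewrite rpow_pos by auto; unfold Rpower, Rdiv; ring. }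
apply Rle_trans with (kappa / (2 ^ n * N) * (c1 * 2 ^ n * (N * (2 * K1 * (a * be) + ra * r4 * t)))).
- apply Rmult_le_compat_l; auto; apply Rmult_le_pos; auto.
  left; apply Rinv_0_lt_compat; now apply Rmult_lt_0_compat.
- replace (kappa / (2 ^ n * N) * (c1 * 2 ^ n * (N * (2 * K1 * (a * be) + ra * r4 * t))))
    with (kappa * c1 * (2 * K1) * (a * be) + kappa * c1 * r4 * (ra * t)) by (field; lra).
  rewrite Rmult_plus_distr_l; apply Rplus_le_compat; apply Rmult_le_compat_r; auto;
    apply Rmult_le_pos; lra.
Qed.

End SchattenNorms.

(** * Constants *)

Lemma ln_le_sub1 x : 0 < x -> ln x <= x - 1.
Proof.
intros Hx; assert (H := exp_ineq1_le (ln x)); rewrite exp_ln in H by auto; lra.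
Qed.

Lemma normalization_exp p : 2 <= p ->
  Rpower (p / sqrt (ln p)) (- p) = exp (p / 2 * (ln (ln p) - 2 * ln p)).
Proof.
intros Hp; assert (l0 : 0 < ln p) by (rewrite <- ln_1; apply ln_increasing; lra).
unfold Rpower; f_equal.
rewrite <- Rpower_sqrt by auto; unfold Rdiv at 1.
rewrite ln_mult, ln_Rinv by (try apply Rinv_0_lt_compat; try apply exp_pos; lra).
unfold Rpower; rewrite ln_exp; field.
Qed.

(** The product of [(ln p / p^2)^(p/2)] and [(2 p)^(p/2)] is [(2 ln p / p)^(p/2)], and [2 <= e]. *)
Lemma khintchine_constant_le p : 2 <= p ->
  Rpower (p / sqrt (ln p)) (- p) * rpow (2 * (p - 1)) (p / 2) <=
  exp (p / 2 * (1 + ln (ln p) - ln p)).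
Proof.
intros Hp; rewrite normalization_exp by auto.
apply Rle_trans with (exp (p / 2 * (ln (ln p) - 2 * ln p)) * rpow (2 * p) (p / 2)).
- apply Rmult_le_compat_l; [left; apply exp_pos|apply rpow_le; lra].
- rewrite rpow_pos, <- exp_plus, ln_mult by lra; apply exp_le.
  assert (ln 2 <= 1) by (assert (H := ln_le_sub1 2); lra).
  nra.
Qed.

(** [kc] is [(e ln p / p)^(p/2)]. It cancels [L^(p/2-1) <= (3 p / ln p)^(p/2)] up to [c^p], and
    against [K2^(p/2) = p^(p/4)] it leaves a power of [ln p / sqrt p], which is bounded. The factor
    [ln p / 3] is [2 s / L] for [s = p/2 - 1]. *)
Lemma large_p_constants p : 4 <= p ->
  let kc := exp (p / 2 * (1 + ln (ln p) - ln p)) in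
  let L := 6 * (p / 2 - 1) / ln p in
  let K2 := exp (ln p / 2) in
  kc * (2 * (K2 * (ln p / 3 * rpow L (p / 2 - 1)))) <= exp (5 * p) /\
  kc * rpow (4 * K2) (p / 2) <= exp (5 * p).
Proof.
intros Hp kc L K2.
assert (l0 : 0 < ln p) by (rewrite <- ln_1; apply ln_increasing; lra).
assert (l1 : ln p <= p - 1) by (apply ln_le_sub1; lra).
set (l := ln p) in *.
assert (e2 : ln 2 <= 1) by (assert (H := ln_le_sub1 2); lra).
assert (e3 : ln 3 <= 2) by (assert (H := ln_le_sub1 3); lra).
split.
- assert (HL : rpow L (p / 2 - 1) <= exp (p / 2 * (2 + l - ln l))).
  { apply Rle_trans with (rpow (3 * p / l) (p / 2 - 1)).
    - apply rpow_le; [lra|]; unfold L; apply Rmult_le_compat_r; [left; now apply Rinv_0_lt_compat|lra].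
    - rewrite rpow_pos by (apply Rdiv_lt_0_compat; lra); apply exp_le.
      assert (E : ln (3 * p / l) = ln 3 + l - ln l).
      { unfold Rdiv; rewrite ln_mult, ln_mult, ln_Rinv by (try apply Rinv_0_lt_compat; lra).
        unfold l; ring. }
      (* Raising the exponent from [p/2 - 1] to [p/2] requires a base of at least 1. *)
      assert (pos : 0 <= ln (3 * p / l)).
      { rewrite <- ln_1; destruct (Req_dec 1 (3 * p / l)) as [->|N]; [lra|].
        left; apply ln_increasing; [lra|].
        assert (1 <= 3 * p / l) by (apply Rmult_le_reg_r with l; auto; field_simplify; lra); lra. }
      apply Rle_trans with (p / 2 * ln (3 * p / l)); [apply Rmult_le_compat_r; lra|].
      rewrite E; apply Rmult_le_compat_l; lra. }
  assert (Hl : 2 * (l / 3) <= exp l) by (assert (H := exp_ineq1_le l); lra).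
  apply Rle_trans with (kc * (exp (l / 2) * (exp l * exp (p / 2 * (2 + l - ln l))))).
  + apply Rmult_le_compat_l; [left; apply exp_pos|].
    replace (2 * (K2 * (l / 3 * rpow L (p / 2 - 1)))) with (K2 * (2 * (l / 3) * rpow L (p / 2 - 1))) by ring.
    apply Rmult_le_compat_l; [left; apply exp_pos|].
    apply Rmult_le_compat; auto; [lra|apply rpow_ge0].
  + unfold kc; rewrite <- !exp_plus; apply exp_le.
    replace (p / 2 * (1 + ln l - l) + (l / 2 + (l + p / 2 * (2 + l - ln l))))
      with (3 * (p / 2) + 3 / 2 * l) by field.
    lra.
- assert (Hl : ln l <= l / 2 + 1).
  { replace l with (2 * (l / 2)) at 1 by field; rewrite ln_mult by lra.
    assert (H := ln_le_sub1 (l / 2)); lra. }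
  assert (e4 : ln 4 <= 3) by (assert (H := ln_le_sub1 4); lra).
  assert (P := exp_pos (l / 2)).
  unfold kc, K2; rewrite rpow_pos by lra; rewrite ln_mult, ln_exp by (auto; lra).
  rewrite <- exp_plus; apply exp_le.
  nra.
Qed.

Theorem mainTheorem16 :
  exists c : R, 0 < c /\
  forall (p : R) (d n k : nat) (A : nat -> Mat),
    2 <= p -> (1 <= k)%nat -> (k <= n)%nat ->
    Rpower (p / sqrt (ln p)) (- p) / (2 ^ n * Binomial.C n k) *
      lsum (ksubsets n k) (fun S => lsum (bvecs n)
        (fun eps => rpow (schatten_norm d p (signed_sum n A S eps)) p))
    <= Rpower c p *
      (INR k / INR n * rsum n (fun j => rpow (schatten_norm d p (A j)) p)
       + Rpower (INR k / INR n) (p / 2) / 2 ^ n *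
         lsum (bvecs n)
           (fun eps => rpow (schatten_norm d p (signed_sum n A (repeat true n) eps)) p)).
Proof.
exists (exp 5); split; [apply exp_pos|]; intros p d n k A Hp Hk Hkn.
replace (Rpower (exp 5) p) with (exp (5 * p)) by (unfold Rpower; rewrite ln_exp; f_equal; ring).
assert (kap0 : 0 <= Rpower (p / sqrt (ln p)) (- p)) by (left; apply exp_pos).
assert (kc := khintchine_constant_le p Hp).
assert (l0 : 0 < ln p) by (rewrite <- ln_1; apply ln_increasing; lra).
(* [p = 4] is [s = 1], where [x^s] passes from concave to convex. *)
destruct (Rle_lt_dec 4 p) as [Hbig|Hsmall].
- (* [L] makes [exp (3 s / L)] equal to [sqrt p], so that the factor [(p / ln p)^(p/2)] is only in [L^s] *)
  destruct (large_p_constants p Hbig) as (C1 & C2).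
  set (L := 6 * (p / 2 - 1) / ln p) in *.
  assert (L0 : 0 < L) by (apply Rdiv_lt_0_compat; lra).
  assert (sL : (p / 2 - 1) / L = ln p / 6) by (unfold L; field; lra).
  assert (K2ge : 1 <= exp (ln p / 2)) by (assert (H := exp_ineq1_le (ln p / 2)); lra).
  assert (rL := rpow_ge0 L (p / 2 - 1)).
  assert (K1ge : 0 <= exp (ln p / 2) * (ln p / 3 * rpow L (p / 2 - 1))) by (repeat apply Rmult_le_pos; lra).
  apply (selection_bound d n A p Hp k _ (exp (ln p / 2) * (ln p / 3 * rpow L (p / 2 - 1))) (exp (ln p / 2))); auto.
  + intros Y C symY symC psdY psdC.
    assert (H := tf_add_convex (d + d) Y C (p / 2 - 1) L ltac:(lra) L0 symY symC psdY psdC).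
    rewrite sL in H; replace (p / 2 - 1 + 1) with (p / 2) in H by ring.
    replace (3 * (ln p / 6)) with (ln p / 2) in H by field.
    apply Rle_trans with (1 := H); apply Req_le; field.
  + apply Rle_trans with (2 := C1); apply Rmult_le_compat_r; [lra|exact kc].
  + apply Rle_trans with (2 := C2); apply Rmult_le_compat_r; [apply rpow_ge0|exact kc].
(* [ln (ln p) <= ln p - 1] makes the exponent in [khintchine_constant_le] nonpositive; with
   [K1 = K2 = 1] only the constants 2 and [4^(p/2)] remain. *)
- assert (kc1 : Rpower (p / sqrt (ln p)) (- p) * rpow (2 * (p - 1)) (p / 2) <= 1).
  { apply Rle_trans with (1 := kc); apply Rle_trans with (exp 0); [apply exp_le|rewrite exp_0; lra].
    assert (H := ln_le_sub1 (ln p) l0); nra. }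
  assert (kc0 : 0 <= Rpower (p / sqrt (ln p)) (- p) * rpow (2 * (p - 1)) (p / 2))
    by (apply Rmult_le_pos; [auto|apply rpow_ge0]).
  apply (selection_bound d n A p Hp k _ 1 1); auto; try lra.
  + intros Y C symY symC psdY psdC.
    assert (H := tf_add_concave (d + d) Y C (p / 2 - 1) ltac:(lra) symY symC psdY psdC).
    replace (p / 2 - 1 + 1) with (p / 2) in H by ring; lra.
  + assert (H := exp_ineq1_le (5 * p)); lra.
  + apply Rle_trans with (rpow (4 * 1) (p / 2)).
    * rewrite <- (Rmult_1_l (rpow (4 * 1) (p / 2))) at 2; apply Rmult_le_compat_r; [apply rpow_ge0|auto].
    * rewrite rpow_pos by lra; apply exp_le.
      assert (H := ln_le_sub1 (4 * 1)); nra.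
Qed.
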